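(* Assume $m \geq n \geq 2$ and $1 \leq i < j \leq n$. The intersection $Z_m^i \cap Z_m^j$ of irreducible components of the singular fiber is of pure dimension, and the following hold. (a) If $m = n$, then $\dim (Z_n^i \cap Z_n^j) = 2n - (j-i) + 1$. (b) Assume $m > n$. (i) If $m - n < j - i$, then $\dim (Z_m^i \cap Z_m^j) = 3m - n - (j-i)$. (ii) If $j - i \leq m - n$, then $\dim (Z_m^i \cap Z_m^j) = 2m$.
   Context: Let $f = xy - z^{n+1} \in \mathbb{C}[x,y,z]$ and $X = \mathrm{Spec}\,\mathbb{C}[x,y,z]/\langle f\rangle$, a surface with an $A_n$-type singularity at the origin. For $m \geq 0$ let $R_m = \mathbb{C}[x_0,\ldots,x_m,y_0,\ldots,y_m,z_0,\ldots,z_m]$, and define $f^{(0)},\ldots,f^{(m)} \in R_m$ by $f(\sum_{k=0}^m x_kt^k, \sum_{k=0}^m y_kt^k, \sum_{k=0}^m z_kt^k) \equiv \sum_{k=0}^m f^{(k)}t^k \pmod{t^{m+1}}$. The $m$-th jet scheme of $X$ is $X_m = \mathrm{Spec}\,R_m/\langle f^{(0)},\ldots,f^{(m)}\rangle \subseteq \mathbb{A}^{3(m+1)}$. For $1 \leq l \leq n$ and $m \geq n$ put $I_m^l = \langle x_0,\ldots,x_{l-1},y_0,\ldots,y_{n-l},z_0,f^{(0)},\ldots,f^{(m)}\rangle \subseteq R_m$ and $Z_m^l = \mathbf{V}(I_m^l) \subseteq \mathbb{A}^{3(m+1)}$ (closed subvariety defined by the ideal). These are the irreducible components of the singular fiber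 $X_m^0 = \pi_m^{-1}(0)$, where $\pi_m : X_m \to X$ is the truncation morphism. *)

(* Defs.v *)
From HB Require Import structures.
From mathcomp Require Import all_boot all_order all_algebra.
From mathcomp Require Import boolp classical_sets reals.
From mathcomp Require Import complex mpoly.

Set Implicit Arguments.
Unset Strict Implicit.
Unset Printing Implicit Defensive.

Import Order.TTheory GRing.Theory Num.Theory.
Local Open Scope classical_set_scope.
Local Open Scope ring_scope.

Definition generated_ideal (A : comNzRingType) (s : seq A) : set A :=
  [set p | exists c : 'I_(size s) -> A, p = \sum_(i < size s) c i * s`_i].

Section AffineSpace.
Variables (K : fieldType) (N : nat).

Definition zero_locus (S : set {mpoly K[N]}) : set ('I_N -> K) :=
  [set v | forall p, S p -> p.@[v] = 0].

Definition zariski_closed (W : set ('I_N -> K)) : Prop :=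
  exists S : set {mpoly K[N]}, W = zero_locus S.

Definition irreducible_closed (W : set ('I_N -> K)) : Prop :=
  [/\ zariski_closed W, W !=set0 &
      forall A B, zariski_closed A -> zariski_closed B ->
        W `<=` A `|` B -> W `<=` A \/ W `<=` B].

Definition irreducible_component (Z W : set ('I_N -> K)) : Prop :=
  [/\ irreducible_closed W, W `<=` Z &
      forall V, irreducible_closed V -> V `<=` Z -> W `<=` V -> V = W].

(* Only meant for a Zariski closed Z: the closed subsets of the space Z are
   then the closed subsets of affine space contained in Z. *)
Definition irreducible_chain (Z : set ('I_N -> K)) (d : nat)
    (F : nat -> set ('I_N -> K)) : Prop :=
  (forall k, (k <= d)%N -> irreducible_closed (F k) /\ F k `<=` Z) /\
  (forall k, (k < d)%N -> F k `<` F k.+1).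

(* Krull dimension, as a relation: the empty set has no dimension. *)
Definition has_dim (Z : set ('I_N -> K)) (d : nat) : Prop :=
  (exists F, irreducible_chain Z d F) /\
  (forall e F, irreducible_chain Z e F -> (e <= d)%N).

Definition pure_dimensional (Z : set ('I_N -> K)) : Prop :=
  exists d, forall W, irreducible_component Z W -> has_dim W d.

End AffineSpace.

Section JetsOfAn.
Variables (K : fieldType) (n m : nat).

Definition An_poly : {mpoly K[3]} :=
  'X_(inord 0) * 'X_(inord 1) - 'X_(inord 2) ^+ n.+1.

(* The variable x_k, y_k or z_k of R_m, for c = 0, 1 or 2 respectively. *)
Definition jet_var (c : 'I_3) (k : 'I_m.+1) : {mpoly K[3 * m.+1]} :=
  'X_(mxvec_index c k).

Definition jet_arc (c : 'I_3) : {poly {mpoly K[3 * m.+1]}} :=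
  \poly_(k < m.+1) jet_var c (inord k).

(* f^(k), the coefficient of t^k in f(x(t), y(t), z(t)). *)
Definition jet_eq (k : nat) : {mpoly K[3 * m.+1]} :=
  (mmap (polyC \o @mpolyC (3 * m.+1) K) jet_arc An_poly)`_k.

(* The generators of I_m^l, meant for 1 <= l <= n <= m: outside this range
   inord would send an index larger than m to 0. *)
Definition component_gens (l : nat) : seq {mpoly K[3 * m.+1]} :=
  [seq jet_var (inord 0) (inord k) | k <- iota 0 l] ++
  [seq jet_var (inord 1) (inord k) | k <- iota 0 (n - l).+1] ++
  jet_var (inord 2) ord0 :: [seq jet_eq k | k <- iota 0 m.+1].

Definition component_ideal (l : nat) : set {mpoly K[3 * m.+1]} :=
  generated_ideal (component_gens l).

Definition Zcomp (l : nat) : set ('I_(3 * m.+1) -> K) :=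
  zero_locus (component_ideal l).

End JetsOfAn.

(* Main.v *)
Require Import Defs.
From HB Require Import structures.
From mathcomp Require Import all_boot all_order all_fingroup all_algebra.
From mathcomp Require Import boolp classical_sets reals.
From mathcomp Require Import complex mpoly.
From mathcomp Require Import zify ring.

(** Write a jet as a triple (x(t), y(t), z(t)) of polynomials truncated at
   t^(m+1).  Put b = n - i + 1.  The intersection of Z^i and Z^j is the set of
   jets with t^j | x, t^b | y, t | z and x y = z^(n+1) modulo t^(m+1), and
   j + b = n + 1 + (j - i).

   If m = n, or if 0 < m - n < j - i, both x y and z^(n+1) vanish
   modulo t^(m+1) once t | z (respectively t^2 | z, which the coefficient of
   t^(n+1) forces), so the intersection is a linear subspace and one counts
   coordinates ([linear_dim]).

   Otherwise t^2 | z is forced as well.  Setting x = t^j u, y = t^b v and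
   z = t^2 w turns the equation into u v = t^e w^(n+1) modulo t^N, where
   e = 2 (n + 1) - (j + b) and N = m + 1 - (j + b).  On the stratum where u has
   order exactly a, for a <= min(N, e), the series u and w are free and v is
   determined modulo t^(N - a), so that the stratum is parametrised by an affine
   space of dimension 2 m ([chart], [chart_covers]).  The closures of these
   strata are irreducible of dimension 2 m, and purity amounts to the fact that
   they cover everything ([charts_cover]).  A jet with u of order greater than N
   is the limit of the jets with u replaced by u + tau t^N.  The essential case
   is u of order alpha with e < alpha <= N: it is a form of the irreducibility
   of the jet schemes of an A_n singularity, but here an explicit deformation
   suffices.  Lift the equation to an exact identity
   t^(alpha - e) U v = w^(n+1) + t^(N - e) r with u = t^alpha U, and replace w by
   w + tau.  The right hand side becomes a polynomial in t that does not vanish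
   at t = 0 for tau <> 0, and over an algebraically closed field it still
   splits.  The product of alpha - e of its linear factors, those whose roots
   tend to 0, is a deformation of t^(alpha - e), and gives one of u with order
   exactly e; the other factors give the deformation of v
   ([high_order_in_closure]).  That the roots, chosen separately for each tau, may
   be followed to tau = 0 as far as polynomial equations are concerned is
   [root_specialization], a consequence of the fundamental theorem on symmetric
   polynomials.

   The dimension theory is elementary.  A strict chain of irreducible closed
   sets of length e in a set provides e polynomials that are algebraically
   independent on it ([chain_independent]), whereas on the image of an affine
   space of dimension d any d + 1 polynomials are dependent, by counting
   monomials ([algebraically_dependent]).  Conversely a flag of coordinate
   subspaces of the parameter space gives a chain of length d
   ([chain_in_chart]).  Irreducibility is tested along parametrised lines
   ([irreducible_zclosure]).  The argument works over every algebraically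
   closed field ([intersection_dim]). *)

Set Implicit Arguments.
Unset Strict Implicit.
Unset Printing Implicit Defensive.

Import Order.TTheory GRing.Theory Num.Theory.
Local Open Scope classical_set_scope.
Local Open Scope ring_scope.

(** * Functions represented by elements of a ring *)

Section RegularFunctions.
Variables (K B : comNzRingType) (T : Type) (ev : T -> {rmorphism B -> K}).

(** Three kinds of polynomial dependence occur below: on a point of an affine
   space, on one parameter, and on a parameter together with a tuple of roots.  In
   each case [ev] is the evaluation of a polynomial ring. *)
Definition regular (f : T -> K) : Prop := exists b, forall t, f t = ev t b.

Lemma regular0 : regular (fun=> 0).
Proof. by exists 0 => t; rewrite rmorph0. Qed.

Lemma regular1 : regular (fun=> 1).
Proof. by exists 1 => t; rewrite rmorph1. Qed.

Lemma regularD f g : regular f -> regular g -> regular (fun t => f t + g t).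
Proof. by move=> [a fa] [b gb]; exists (a + b) => t; rewrite rmorphD fa gb. Qed.

Lemma regularN f : regular f -> regular (fun t => - f t).
Proof. by move=> [a fa]; exists (- a) => t; rewrite rmorphN fa. Qed.

Lemma regularM f g : regular f -> regular g -> regular (fun t => f t * g t).
Proof. by move=> [a fa] [b gb]; exists (a * b) => t; rewrite rmorphM fa gb. Qed.

Lemma regularX f k : regular f -> regular (fun t => f t ^+ k).
Proof. by move=> [a fa]; exists (a ^+ k) => t; rewrite rmorphXn fa. Qed.

Lemma regular_sum I (r : seq I) (P : pred I) (F : I -> T -> K) :
  (forall i, regular (F i)) -> regular (fun t => \sum_(i <- r | P i) F i t).
Proof.
move=> rF; elim: r => [|i r IH].
  by have [b eb] := regular0; exists b => t; rewrite big_nil -eb.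
have [b eb] := IH; have [c ec] := rF i.
exists (if P i then c + b else b) => t; rewrite big_cons.
by case: (P i); rewrite ?rmorphD eb ?ec.
Qed.

Lemma regular_prod I (r : seq I) (P : pred I) (F : I -> T -> K) :
  (forall i, regular (F i)) -> regular (fun t => \prod_(i <- r | P i) F i t).
Proof.
move=> rF; elim: r => [|i r IH].
  by have [b eb] := regular1; exists b => t; rewrite big_nil -eb.
have [b eb] := IH; have [c ec] := rF i.
exists (if P i then c * b else b) => t; rewrite big_cons.
by case: (P i); rewrite ?rmorphM eb ?ec.
Qed.

Lemma regular_ext f g : f =1 g -> regular f -> regular g.
Proof. by move=> fg [b eb]; exists b => t; rewrite -fg. Qed.

Hypothesis regularC : forall c, regular (fun=> c).

Lemma regular_meval N (phi : T -> 'I_N -> K) (p : {mpoly K[N]}) :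
  (forall i, regular (fun t => phi t i)) -> regular (fun t => p.@[phi t]).
Proof.
move=> rphi; apply: (@regular_ext
  (fun t => \sum_(mm <- msupp p) p@_mm * \prod_(i < N) phi t i ^+ mm i)).
  by move=> t; rewrite mevalE.
apply: regular_sum => mm; apply: regularM; first exact: regularC.
by apply: regular_prod => i; apply: regularX.
Qed.

(** A polynomial in t that varies polynomially with a parameter. *)
Definition regularp (F : T -> {poly K}) : Prop :=
  forall k, regular (fun t => (F t)`_k).

Lemma regularpD F G : regularp F -> regularp G -> regularp (fun t => F t + G t).
Proof.
move=> rF rG k; apply: regular_ext (regularD (rF k) (rG k)) => t.
by rewrite coefD.
Qed.

Lemma regularpM F G : regularp F -> regularp G -> regularp (fun t => F t * G t).
Proof.
move=> rF rG k.
apply: (@regular_ext (fun t => \sum_(i < k.+1) (F t)`_i * (G t)`_(k - i))).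
  by move=> t; rewrite coefM.
by apply: regular_sum => i; apply: regularM.
Qed.

Lemma regularpC (p : {poly K}) : regularp (fun=> p).
Proof. by move=> k; apply: regularC. Qed.

Lemma regularp_polyC f : regular f -> regularp (fun t => (f t)%:P).
Proof.
move=> rf k; apply: (@regular_ext (fun t => if k == 0%N then f t else 0)).
  by move=> t; rewrite coefC.
case: eqP => _; [exact: rf | exact: regular0].
Qed.

Lemma regularpN F : regularp F -> regularp (fun t => - F t).
Proof.
by move=> rF k; apply: regular_ext (regularN (rF k)) => t; rewrite coefN.
Qed.

Lemma regularpX F k : regularp F -> regularp (fun t => F t ^+ k).
Proof.
move=> rF; elim: k => [|k IH].
  by move=> l; apply: regular_ext (regularpC 1 l) => t; rewrite expr0.
by move=> l; apply: regular_ext (regularpM rF IH l) => t; rewrite exprS.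
Qed.

Lemma regularp_sum I (r : seq I) (P : pred I) (F : I -> T -> {poly K}) :
  (forall i, regularp (F i)) -> regularp (fun t => \sum_(i <- r | P i) F i t).
Proof.
move=> rF k; apply: (@regular_ext (fun t => \sum_(i <- r | P i) (F i t)`_k)).
  by move=> t; rewrite coef_sum.
by apply: regular_sum => i; apply: rF.
Qed.

Lemma regularp_prod I (r : seq I) (P : pred I) (F : I -> T -> {poly K}) :
  (forall i, regularp (F i)) -> regularp (fun t => \prod_(i <- r | P i) F i t).
Proof.
move=> rF; elim: r => [|i r IH] k.
  by apply: regular_ext (regularpC 1 k) => t; rewrite big_nil.
case Pi : (P i); last by apply: regular_ext (IH k) => t; rewrite big_cons Pi.
by apply: regular_ext (regularpM (rF i) IH k) => t; rewrite big_cons Pi.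
Qed.

Lemma regularp_take k F : regularp F -> regularp (fun t => take_poly k (F t)).
Proof.
move=> rF l; apply: (@regular_ext (fun t => if (l < k)%N then (F t)`_l else 0)).
  by move=> t; rewrite coef_take_poly.
case: (l < k)%N; [exact: rF | exact: regular0].
Qed.

Lemma regularp_poly k (F : nat -> T -> K) :
  (forall l, regular (F l)) -> regularp (fun t => \poly_(l < k) F l t).
Proof.
move=> rF l; apply: (@regular_ext (fun t => if (l < k)%N then F l t else 0)).
  by move=> t; rewrite coef_poly.
case: (l < k)%N; [exact: rF | exact: regular0].
Qed.

End RegularFunctions.

Section Evaluations.
Variable K : comNzRingType.

Definition mpoly_ev d (v : 'I_d -> K) : {rmorphism {mpoly K[d]} -> K} := meval v.
Definition poly_ev (x : K) : {rmorphism {poly K} -> K} := horner_eval x.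
(** Polynomials in d variables whose coefficients are polynomials in a
   parameter; the variables are kept apart from it because symmetric functions
   are taken with respect to the variables only. *)
Definition family_ev d (p : ('I_d -> K) * K) :
  {rmorphism {mpoly {poly K}[d]} -> K} := mmap (horner_eval p.2) p.1.

Lemma regular_mpolyC d c : regular (@mpoly_ev d) (fun=> c).
Proof. by exists c%:MP => v; rewrite /= mevalC. Qed.

Lemma regular_mpolyX d i : regular (@mpoly_ev d) (fun v => v i).
Proof. by exists 'X_i => v; rewrite /= mevalXU. Qed.

Lemma regular_polyC c : regular poly_ev (fun=> c).
Proof. by exists c%:P => v; rewrite /= /horner_eval hornerC. Qed.

Lemma regular_polyX : regular poly_ev id.
Proof. by exists 'X => v; rewrite /= /horner_eval hornerX. Qed.

Lemma regular_familyC d c : regular (@family_ev d) (fun=> c).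
Proof. by exists (c%:P)%:MP => v; rewrite /= mmapC /= /horner_eval hornerC. Qed.

Lemma regular_family_root d i : regular (@family_ev d) (fun p => p.1 i).
Proof. by exists 'X_i => v; rewrite /= mmapX mmap1U. Qed.

Lemma regular_family_param d : regular (@family_ev d) (fun p => p.2).
Proof. by exists ('X%:MP) => v; rewrite /= mmapC /= /horner_eval hornerX. Qed.

End Evaluations.

(** * Zariski closures and chains *)

Section Zariski.
Variables (K : fieldType) (N : nat).
Implicit Types (S W A B : set ('I_N -> K)).

Definition vanishing S : set {mpoly K[N]} := [set p | forall v, S v -> p.@[v] = 0].

Definition zclosure S := zero_locus (vanishing S).

Lemma sub_zclosure S : S `<=` zclosure S.
Proof. by move=> v Sv p; apply. Qed.

Lemma zclosure_closed S : zariski_closed (zclosure S).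
Proof. by exists (vanishing S). Qed.

Lemma zclosure_sub S W : zariski_closed W -> S `<=` W -> zclosure S `<=` W.
Proof.
move=> [P ->] SW v clv p Pp; apply: clv => w Sw; exact: SW Pp.
Qed.

Lemma zclosureS S W : S `<=` W -> zclosure S `<=` zclosure W.
Proof.
by move=> SW; apply: zclosure_sub (zclosure_closed W) _ => v /SW/sub_zclosure.
Qed.

Lemma zariski_closedU A B :
  zariski_closed A -> zariski_closed B -> zariski_closed (A `|` B).
Proof.
move=> [P ->] [Q ->]; exists [set r | exists p q, [/\ P p, Q q & r = p * q]].
apply/seteqP; split => [v PQv _ [p [q [Pp Qq ->]]]|v PQv].
  rewrite mevalM; case: PQv => [/(_ p Pp)|/(_ q Qq)] ->; first by rewrite mul0r.
  by rewrite mulr0.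
apply: contrapT => /not_orP[/existsNP[p /not_implyP[Pp nzp]]].
move=> /existsNP[q /not_implyP[Qq nzq]].
have /eqP := PQv (p * q) (ex_intro _ p (ex_intro _ q (And3 Pp Qq erefl))).
by rewrite mevalM mulf_eq0 => /orP[] /eqP.
Qed.

Lemma zariski_closedI A B :
  zariski_closed A -> zariski_closed B -> zariski_closed (A `&` B).
Proof.
move=> [P ->] [Q ->]; exists (P `|` Q); apply/seteqP; split.
  by move=> v [Pv Qv] p [/Pv|/Qv].
by move=> v PQv; split=> p Pp; apply: PQv; [left|right].
Qed.

Lemma zariski_closed_locus (p : {mpoly K[N]}) :
  zariski_closed [set v | p.@[v] = 0].
Proof.
by exists [set p]; apply/seteqP; split=> v pv; [move=> _ ->|apply: pv].
Qed.

Lemma irreducible_prime W (p q : {mpoly K[N]}) : irreducible_closed W ->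
  vanishing W (p * q) -> vanishing W p \/ vanishing W q.
Proof.
move=> [_ _ irrW] Wpq.
apply: (irrW _ _ (zariski_closed_locus p) (zariski_closed_locus q)) => v Wv.
have /eqP := Wpq v Wv.
by rewrite mevalM mulf_eq0 => /orP[] /eqP; [left|right].
Qed.

(** Irreducibility is a statement about two closed sets; finite covers follow
   since finite unions of closed sets are closed. *)
Lemma irreducible_cover W r (C : nat -> set ('I_N -> K)) :
    irreducible_closed W -> (forall a, zariski_closed (C a)) ->
    (forall v, W v -> exists2 a, (a <= r)%N & C a v) ->
  exists2 a, (a <= r)%N & W `<=` C a.
Proof.
move=> [clW W0 irrW] clC.
have clU k : zariski_closed [set v | exists2 a, (a <= k)%N & C a v].
  elim: k => [|k IH].
    have -> : [set v | exists2 a, (a <= 0)%N & C a v] = C 0%N; last exact: clC.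
    apply/seteqP; split=> [v [a]|v Cv]; last by exists 0%N.
    by rewrite leqn0 => /eqP ->.
  have -> : [set v | exists2 a, (a <= k.+1)%N & C a v] =
      [set v | exists2 a, (a <= k)%N & C a v] `|` C k.+1.
    apply/seteqP; split=> [v [a]|v [[a ak Cv]|Cv]].
    - rewrite leq_eqVlt => /orP[/eqP ->|ak] Cv; first by right.
      by left; exists a.
    - by exists a => //; apply: leqW.
    - by exists k.+1.
  exact: zariski_closedU.
elim: r => [|r IH] covW.
  exists 0%N => // v /covW[a]; by rewrite leqn0 => /eqP ->.
have [|/IH[a ar WC]|WC] := irrW _ _ (clU r) (clC r.+1).
- move=> v /covW[a]; rewrite leq_eqVlt => /orP[/eqP ->|ar] Cv; first by right.
  by left; exists a.
- by exists a => //; apply: leqW.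
- by exists r.+1.
Qed.

(** The monomial in the [g i], [i < e], whose exponents are the base-[D] digits
   of [k]: for [k < D ^ e] these run once through the monomials whose exponents
   are all less than [D].  Indexing them by an integer makes the last variable
   split off by Euclidean division. *)
Definition digit_monomial (A : comNzRingType) (g : nat -> A) D e k : A :=
  \prod_(i < e) g i ^+ (k %/ D ^ i %% D).

Lemma digit_monomialS (A : comNzRingType) (g : nat -> A) D e q r :
  (q < D)%N -> (r < D ^ e)%N ->
  digit_monomial g D e.+1 (q * D ^ e + r) = digit_monomial g D e r * g e ^+ q.
Proof.
move=> qD rD; rewrite /digit_monomial big_ord_recr /=; congr (_ * _); last first.
  have De : (0 < D ^ e)%N by apply: leq_ltn_trans rD.
  by rewrite divnMDl // divn_small // addn0 modn_small.
apply: eq_bigr => i _; congr (_ ^+ _).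
have D0 : (0 < D)%N by apply: leq_ltn_trans qD.
have -> : (D ^ e = D ^ (e - i.+1) * D * D ^ i)%N.
  by rewrite -expnSr -expnD -subSn // subSS subnK // ltnW.
by rewrite mulnA divnMDl ?expn_gt0 ?D0 // mulnA modnMDl.
Qed.

Lemma digit_monomial_morph (A A' : comNzRingType) (h : {rmorphism A -> A'})
    (g : nat -> A) D e k :
  h (digit_monomial g D e k) = digit_monomial (h \o g) D e k.
Proof. by rewrite rmorph_prod; apply: eq_bigr => i _; rewrite rmorphXn. Qed.

Lemma big_digits (A : nmodType) D e (F : nat -> A) :
  \sum_(k < D ^ e.+1) F k = \sum_(q < D) \sum_(r < D ^ e) F (q * D ^ e + r)%N.
Proof.
rewrite -(big_mkord xpredT F) expnS big_nat_mul big_mkord.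
apply: eq_bigr => q _; rewrite mulSn -{1}[(q * _)%N]add0n big_addn addnK big_mkord.
by apply: eq_bigr => r _; rewrite addnC.
Qed.

(** View a relation on [F e.+1] as a polynomial in the last function [g e].  The
   lowest power of [g e] can be cancelled because [F e.+1] is irreducible and
   [g e] is not identically zero on it; restricting to [F e], where [g e]
   vanishes, then kills all but the lowest coefficient, which is a relation
   between the preceding functions.  So the [g k] are algebraically independent
   on the top of the chain. *)
Lemma chain_independent (F : nat -> set ('I_N -> K)) (g : nat -> {mpoly K[N]})
    e D (c : nat -> K) :
    (forall k, (k <= e)%N -> irreducible_closed (F k)) ->
    (forall k, (k < e)%N -> F k `<=` F k.+1) ->
    (forall k, (k < e)%N -> vanishing (F k) (g k) /\ ~ vanishing (F k.+1) (g k)) ->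
    vanishing (F e) (\sum_(k < D ^ e) c k *: digit_monomial g D e k) ->
  forall k, (k < D ^ e)%N -> c k = 0.
Proof.
elim: e c => [|e IH] c irrF incF gF vanF k ke.
  have [_ [v Fv] _] := irrF 0%N isT.
  have := vanF v Fv; rewrite expn0 big_ord1 /digit_monomial big_ord0.
  by rewrite mevalZ meval1 mulr1 => c0; case: k ke.
pose h q := \sum_(r < D ^ e) c (q * D ^ e + r)%N *: digit_monomial g D e r.
have hE : \sum_(k < D ^ e.+1) c k *: digit_monomial g D e.+1 k =
          \sum_(q < D) h q * g e ^+ q.
  rewrite (big_digits _ _ (fun k => c k *: digit_monomial g D e.+1 k)).
  apply: eq_bigr => q _; rewrite mulr_suml; apply: eq_bigr => r _.
  by rewrite digit_monomialS // scalerAl.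
have c0 q : (q < D)%N -> forall r, (r < D ^ e)%N -> c (q * D ^ e + r)%N = 0.
  elim/ltn_ind: q => q IHq qD.
  apply: (IH (fun r => c (q * D ^ e + r)%N)).
  - by move=> l le; apply: irrF; apply: leqW.
  - by move=> l le; apply: incF; apply: leqW.
  - by move=> l le; apply: gF; apply: leqW.
  rewrite -/(h q).
  pose rest := \sum_(q.+1 <= l < D) h l * g e ^+ (l - q.+1).
  have sumE : \sum_(l < D) h l * g e ^+ l = g e ^+ q * (h q + g e * rest).
    rewrite -(big_mkord xpredT (fun l => h l * g e ^+ l)).
    rewrite (big_cat_nat (n := q)) ?(ltnW qD) //= [X in X + _]big1_seq ?add0r.
      rewrite big_ltn // mulrDr mulrC; congr (_ + _).
      rewrite mulrA -exprSr mulr_sumr big_nat_cond [RHS]big_nat_cond.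
      apply: eq_bigr => l /andP[/andP[ql _] _].
      by rewrite mulrCA -exprD subnKC.
    move=> l; rewrite mem_index_iota => /andP[_ lq]; rewrite /h big1 ?mul0r // => r _.
    by rewrite (IHq l lq (ltn_trans lq qD)) ?scale0r.
  have [vang nvang] := gF e (leqnn _).
  rewrite hE sumE in vanF.
  have irr := irrF e.+1 (leqnn _).
  (* The lowest coefficient not yet known to vanish is isolated by cancelling
     the power of g e in front. *)
  have cancel_g l p : vanishing (F e.+1) (g e ^+ l * p) -> vanishing (F e.+1) p.
    elim: l => [|l IHl]; first by rewrite expr0 mul1r.
    by rewrite exprS -mulrA => /(irreducible_prime irr)[].
  have {}vanF := cancel_g q _ vanF.
  move=> v Fv; have := vanF v (incF e (leqnn _) v Fv).
  by rewrite mevalD mevalM vang // mul0r addr0.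
have De : (0 < D ^ e)%N by move: ke; rewrite expnS; case: (D ^ e)%N; rewrite ?muln0.
rewrite (divn_eq k (D ^ e)); apply: c0; last by rewrite ltn_mod.
by rewrite ltn_divLR // -expnS.
Qed.

End Zariski.

(** * Algebraic dependence and dimension *)

Section Dependence.
Variables (K : fieldType) (d : nat).

Definition mdeg_le (p : {mpoly K[d]}) b := forall mm, mm \in msupp p -> (mdeg mm <= b)%N.

Lemma mdeg_leM p q a b : mdeg_le p a -> mdeg_le q b -> mdeg_le (p * q) (a + b).
Proof.
move=> pa qb mm /msuppM_le /allpairsP[[m1 m2] /= [m1p m2q ->]].
by rewrite mdegD leq_add ?pa ?qb.
Qed.

Lemma mdeg_leX p a k : mdeg_le p a -> mdeg_le (p ^+ k) (k * a).
Proof.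
move=> pa; elim: k => [|k IH]; last by rewrite exprS mulSn; apply: mdeg_leM.
by move=> mm; rewrite expr0 msupp1 inE => /eqP ->; rewrite mdeg0.
Qed.

Lemma mdeg_le_digit_monomial (P : nat -> {mpoly K[d]}) D e s k : (0 < D)%N ->
  (forall i, (i < e)%N -> mdeg_le (P i) s) ->
  mdeg_le (digit_monomial P D e k) (e * (D * s)).
Proof.
move=> D0 Ps; rewrite /digit_monomial; elim: e Ps => [|e IH] Ps.
  by move=> mm; rewrite big_ord0 msupp1 inE => /eqP ->; rewrite mdeg0.
rewrite big_ord_recr /= mulSn addnC; apply: mdeg_leM.
  by apply: IH => i ie; apply: Ps; apply: leqW.
move=> mm /(mdeg_leX (Ps e (leqnn _))) /leq_trans -> //.
by rewrite leq_mul2r ltnW ?orbT // ltn_mod.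
Qed.

Lemma card_bmultinom b : (#|{: 'X_{1..d < b.+1}}| <= b.+1 ^ d)%N.
Proof.
pose f (mm : 'X_{1..d < b.+1}) : {ffun 'I_d -> 'I_b.+1} := [ffun i => inord (mm i)].
rewrite -[X in (_ <= X ^ _)%N]card_ord -{6}(card_ord d) -card_ffun.
apply: (@leq_card _ _ f) => m1 m2 /ffunP f12; apply/val_inj/mnmP => i.
have small (mm : 'X_{1..d < b.+1}) : (mm i < b.+1)%N.
  by apply: leq_ltn_trans (bmdeg mm); rewrite mdegE (bigD1 i) //= leq_addr.
by have := congr1 val (f12 i); rewrite !ffunE /= !inordK.
Qed.

(** Let [s] bound the degrees of the [P i].  The [D ^ e] monomials with exponents
   less than [D] have degree at most [e * D * s], hence lie in a space whose
   dimension grows with [D] only like [D ^ d], and [d < e]. *)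
Lemma algebraically_dependent (P : nat -> {mpoly K[d]}) e : (d < e)%N ->
  exists D (c : nat -> K),
    (exists2 k, (k < D ^ e)%N & c k != 0) /\
    \sum_(k < D ^ e) c k *: digit_monomial P D e k = 0.
Proof.
move=> de.
pose s := (\max_(i < e) msize (P i))%N.
have Ps i : (i < e)%N -> mdeg_le (P i) s.
  move=> ie mm /msize_mdeg_lt/ltnW/leq_trans; apply.
  exact: (@leq_bigmax _ (fun i : 'I_e => msize (P i)) (Ordinal ie)).
(* The number of columns is at most (e s + 1)^d D^d, and this D exceeds the first
   factor. *)
pose D := ((e * s).+1 ^ d).+1; pose b := (e * (D * s))%N; exists D.
have ltD : (#|{: 'X_{1..d < b.+1}}| < D ^ e)%N.
  apply: leq_ltn_trans (card_bmultinom b) _.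
  have : (b.+1 ^ d <= ((e * s).+1 * D) ^ d)%N.
    have : (b.+1 <= (e * s).+1 * D)%N by rewrite /b; nia.
    by move=> bD; elim: (d) => // l IHl; rewrite !expnS leq_mul.
  move=> /leq_ltn_trans; apply; rewrite expnMn.
  apply: (@leq_trans (D ^ d.+1)%N); last by rewrite leq_pexp2l.
  by rewrite expnS ltn_pmul2r ?expn_gt0.
pose M : 'M[K]_(D ^ e, #|{: 'X_{1..d < b.+1}}|) :=
  \matrix_(k, x) (digit_monomial P D e k)@_(val (enum_val x)).
have : kermx M != 0.
  rewrite -mxrank_eq0 mxrank_ker -lt0n subn_gt0.
  exact: leq_ltn_trans (rank_leq_col M) ltD.
move=> /rowV0Pn[r /sub_kermxP rM r0].
pose c k := if insub k is Some i then r 0 i else 0.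
have cE (i : 'I_(D ^ e)) : c i = r 0 i by rewrite /c valK.
exists c; split.
  have /rV0Pn[i ri] := r0.
  by exists (val i); [exact: ltn_ord | rewrite cE].
apply/mpolyP => mm; rewrite mcoeff0 raddf_sum /=.
under eq_bigr do rewrite mcoeffZ cE.
have [mmb|bmm] := ltnP (mdeg mm) b.+1.
  have := congr1 (fun A : 'rV__ => A 0 (enum_rank (BMultinom mmb))) rM.
  rewrite !mxE; apply: etrans; apply: eq_bigr => k _.
  by rewrite mxE enum_rankK.
rewrite big1 // => k _; rewrite memN_msupp_eq0 ?mulr0 //; apply/negP.
by move=> /(@mdeg_le_digit_monomial P D e s k isT Ps); rewrite leqNgt bmm.
Qed.

End Dependence.

Section Charts.
Variables (K : closedFieldType) (N : nat).

Lemma poly_vanish (p : {poly K}) : (forall x, p.[x] = 0) -> p = 0.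
Proof.
by move=> p0; apply/eqP; apply: contraT => /closed_nonrootP[x]; rewrite /root p0 eqxx.
Qed.

Definition curve (gamma : K -> 'I_N -> K) :=
  forall i, regular (@poly_ev K) (fun t => gamma t i).

Lemma curve_meval gamma (p : {mpoly K[N]}) : curve gamma ->
  exists q : {poly K}, forall t, p.@[gamma t] = q.[t].
Proof. by move=> cg; apply: regular_meval cg; apply: regular_polyC. Qed.

(** A polynomial in one variable that vanishes away from 0 vanishes at 0. *)
Lemma zclosure_limit (S : set ('I_N -> K)) gamma : curve gamma ->
  (forall t, t != 0 -> zclosure S (gamma t)) -> zclosure S (gamma 0).
Proof.
move=> cg Sg p vp; have [q pq] := curve_meval p cg; rewrite pq.
suff /eqP : q * 'X = 0 by rewrite mulf_eq0 polyX_eq0 orbF => /eqP ->; rewrite horner0.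
apply: poly_vanish => t; rewrite hornerMX; have [->|t0] := eqVneq t 0.
  by rewrite mulr0.
by rewrite -pq (Sg t t0 p vp) mul0r.
Qed.

(** Two polynomials that do not vanish identically on [S] are nonzero at two
   points of [S]; along a polynomial curve in [S] through these points they
   become nonzero polynomials in one variable, so that their product is nonzero
   somewhere on the curve. *)
Lemma irreducible_zclosure (S : set ('I_N -> K)) : S !=set0 ->
    (forall v w, S v -> S w ->
      exists2 gamma, curve gamma & [/\ gamma 0 = v, gamma 1 = w & forall t, S (gamma t)]) ->
  irreducible_closed (zclosure S).
Proof.
move=> [v0 Sv0] pathS; split.
- exact: zclosure_closed.
- by exists v0; apply: sub_zclosure.
move=> A B clA clB SAB; apply: contrapT => /not_orP[nA nB].
have [v Sv nAv] : exists2 v, S v & ~ A v.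
  by apply: contrapT => H; apply: nA; apply: zclosure_sub => // v Sv;
    apply: contrapT => nv; apply: H; exists v.
have [w Sw nBw] : exists2 w, S w & ~ B w.
  by apply: contrapT => H; apply: nB; apply: zclosure_sub => // w Sw;
    apply: contrapT => nw; apply: H; exists w.
have [gamma cg [g0 g1 Sg]] := pathS v w Sv Sw.
move: clA clB => [P AP] [Q BQ].
move: nAv; rewrite AP => /existsNP[p /not_implyP[Pp nzp]].
move: nBw; rewrite BQ => /existsNP[q /not_implyP[Qq nzq]].
have [p' pp'] := curve_meval p cg; have [q' qq'] := curve_meval q cg.
have /eqP : p' * q' = 0.
  apply: poly_vanish => t; rewrite hornerM -pp' -qq'.
  have := SAB _ (sub_zclosure (Sg t)); rewrite AP BQ.
  by move=> [/(_ p Pp)|/(_ q Qq)] ->; rewrite ?mul0r ?mulr0.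
rewrite mulf_eq0 => /orP[]/eqP r0.
  by apply: nzp; rewrite -g0 pp' r0 horner0.
by apply: nzq; rewrite -g1 qq' r0 horner0.
Qed.

Definition polynomial_map d (phi : ('I_d -> K) -> 'I_N -> K) :=
  forall i, regular (@mpoly_ev K d) (fun s => phi s i).

Lemma curve_comp d (phi : ('I_d -> K) -> 'I_N -> K) (gamma : K -> 'I_d -> K) :
  polynomial_map phi -> (forall i, regular (@poly_ev K) (fun t => gamma t i)) ->
  curve (phi \o gamma).
Proof.
move=> pphi cg i; have [p pE] := pphi i.
have [q qE] := regular_meval (@regular_polyC K) p cg.
by exists q => t; rewrite -qE /= pE.
Qed.

(** The [iota i]-th coordinate of the target detects the passage from the [i]-th
   to the next member of the flag of coordinate subspaces through [s0], so that
   the closures of their images increase strictly.  This is all that is needed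
   of a left inverse of [phi]. *)
Definition flag_chart d (phi : ('I_d -> K) -> 'I_N -> K) :=
  exists (s0 : 'I_d -> K) (iota : 'I_d -> 'I_N), forall i,
    (forall s, s i = s0 i -> phi s (iota i) = s0 i) /\
    (exists s, (forall j : 'I_d, (i < j)%N -> s j = s0 j) /\ phi s (iota i) != s0 i).

Section Image.
Variables (d : nat) (phi : ('I_d -> K) -> 'I_N -> K).
Hypothesis pphi : polynomial_map phi.

Definition flat_image (s0 : 'I_d -> K) k : set ('I_N -> K) :=
  [set v | exists2 s : 'I_d -> K, (forall j : 'I_d, (k <= j)%N -> s j = s0 j) & v = phi s].

Lemma irreducible_flat_image s0 k : irreducible_closed (zclosure (flat_image s0 k)).
Proof.
apply: irreducible_zclosure; first by exists (phi s0); exists s0.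
move=> _ _ [s sk ->] [s' s'k ->].
exists (phi \o (fun t i => s i + t * (s' i - s i))).
  apply: curve_comp => // i; apply: regularD; first exact: regular_polyC.
  by apply: regularM; [apply: regular_polyX | apply: regular_polyC].
split=> /=.
- by congr phi; apply/funext => i; rewrite mul0r addr0.
- by congr phi; apply/funext => i; rewrite mul1r addrC subrK.
move=> t; exists (fun i => s i + t * (s' i - s i)) => // j kj.
by rewrite sk // s'k // subrr mulr0 addr0.
Qed.

Definition image_closure := zclosure (range phi).

Lemma image_closureE s0 : image_closure = zclosure (flat_image s0 d).
Proof.
congr zclosure; apply/seteqP; split=> [_ [s _ <-]|_ [s _ ->]]; last by exists s.
by exists s => // j; rewrite leqNgt ltn_ord.
Qed.

Lemma irreducible_image_closure : irreducible_closed image_closure.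
Proof. rewrite (image_closureE (fun=> 0)); exact: irreducible_flat_image. Qed.

Lemma chain_in_chart : flag_chart phi ->
  exists F, irreducible_chain image_closure d F.
Proof.
move=> [s0 [iota chart]]; exists (fun k => zclosure (flat_image s0 k)); split.
  move=> k kd; split; first exact: irreducible_flat_image.
  by apply: zclosureS => _ [s _ ->]; exists s.
move=> k kd; have [fix_s0 [s [s_flat s_move]]] := chart (Ordinal kd).
split.
  by apply: zclosureS => _ [s' s'k ->]; exists s' => // j kj; apply: s'k; apply: ltnW.
move=> sub; pose p : {mpoly K[N]} := 'X_(iota (Ordinal kd)) - (s0 (Ordinal kd))%:MP.
have pE v : p.@[v] = v (iota (Ordinal kd)) - s0 (Ordinal kd).
  by rewrite mevalB mevalXU mevalC.
have van : vanishing (flat_image s0 k) p.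
  by move=> _ [s' s'k ->]; rewrite pE fix_s0 ?subrr // s'k.
have /eqP := sub (phi s) (sub_zclosure (ex_intro2 _ _ s s_flat erefl)) p van.
by rewrite pE subr_eq0 (negbTE s_move).
Qed.

(** The polynomials that are independent along the chain pull back to the
   parameter space, where more than [d] of them are dependent. *)
Lemma chain_bound e F : irreducible_chain image_closure e F -> (e <= d)%N.
Proof.
move=> [irrF incF]; rewrite leqNgt; apply/negP => de.
have ex k : exists g, (k < e)%N -> vanishing (F k) g /\ ~ vanishing (F k.+1) g.
  have [ke|] := boolP (k < e)%N; last by exists 0.
  have [_ nsub] := incF k ke; have [[[P FP] _ _] _] := irrF k (ltnW ke).
  have /existsNP[v /not_implyP[Fv nFv]] := nsub.
  move: nFv; rewrite FP => /existsNP[g /not_implyP[Pg gv]].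
  exists g => _; split; last by move=> /(_ v Fv).
  by move=> w; apply.
pose g k := projT1 (cid (ex k)).
have gP k : (k < e)%N -> vanishing (F k) (g k) /\ ~ vanishing (F k.+1) (g k).
  exact: (projT2 (cid (ex k))).
have exP k : exists P : {mpoly K[d]}, forall s, (g k).@[phi s] = P.@[s].
  by have [P PE] := regular_meval (@regular_mpolyC K d) (g k) pphi; exists P => s; rewrite PE.
pose P k := projT1 (cid (exP k)).
have PE k s : (g k).@[phi s] = (P k).@[s] by exact: (projT2 (cid (exP k))).
have [D [c [[k ke ck] sumP]]] := algebraically_dependent P de.
have irr l : (l <= e)%N -> irreducible_closed (F l) by move=> /irrF[].
have inc l : (l < e)%N -> F l `<=` F l.+1 by move=> /incF[].
have van : vanishing (F e) (\sum_(l < D ^ e) c l *: digit_monomial g D e l).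
  move=> v Fv; have [_ /(_ v Fv)] := irrF e (leqnn _); apply => _ [s _ <-].
  have := congr1 (fun p => p.@[s]) sumP; rewrite meval0 => <-.
  rewrite !raddf_sum /=; apply: eq_bigr => l _; rewrite !mevalZ; congr (_ * _).
  rewrite (digit_monomial_morph (mpoly_ev (phi s))) (digit_monomial_morph (mpoly_ev s)).
  by apply: eq_bigr => i _ /=; rewrite PE.
by have /eqP := chain_independent irr inc gP van ke; rewrite (negbTE ck).
Qed.

End Image.

(** Every irreducible closed subset of [Z], in particular every component, lies
   in the closure of the image of one chart, and these closures are irreducible
   of dimension [d]; so the components are among them. *)
Theorem dim_of_charts (Z : set ('I_N -> K)) d r
    (phi : nat -> ('I_d -> K) -> 'I_N -> K) :
    zariski_closed Z ->
    (forall a, polynomial_map (phi a)) ->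
    (forall a, (a <= r)%N -> flag_chart (phi a)) ->
    (forall a s, (a <= r)%N -> Z (phi a s)) ->
    (forall v, Z v -> exists2 a, (a <= r)%N & image_closure (phi a) v) ->
  pure_dimensional Z /\ has_dim Z d.
Proof.
move=> clZ pphi chart phiZ cov.
have imZ a : (a <= r)%N -> image_closure (phi a) `<=` Z.
  by move=> ar; apply: zclosure_sub => // _ [s _ <-]; apply: phiZ.
have sub W : irreducible_closed W -> W `<=` Z ->
    exists2 a, (a <= r)%N & W `<=` image_closure (phi a).
  move=> irrW WZ; apply: irreducible_cover => // [a|v /WZ/cov //].
  exact: zclosure_closed.
split; last split.
- exists d => W [irrW WZ maxW]; have [a ar Wa] := sub W irrW WZ.
  have <- := maxW _ (irreducible_image_closure (pphi a)) (imZ a ar) Wa.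
  split; first exact: chain_in_chart (chart a ar).
  by move=> e F /(chain_bound (pphi a)).
- have [F [irrF incF]] := chain_in_chart (pphi 0%N) (chart 0%N isT).
  exists F; split=> // k /irrF[irrFk Fk]; split=> //.
  exact: subset_trans Fk (imZ 0%N isT).
- move=> e F [irrF incF]; have [irrFe FeZ] := irrF e (leqnn _).
  have [a ar Fa] := sub _ irrFe FeZ.
  apply: (chain_bound (pphi a) (F := F)); split=> // k ke.
  split; first by have [] := irrF k ke.
  suff incr l : (k + l <= e)%N -> F k `<=` F (k + l)%N.
    by apply: subset_trans Fa; rewrite -(subnKC ke); apply: incr; rewrite subnKC.
  elim: l => [|l IH] kl; first by rewrite addn0.
  rewrite addnS in kl *; apply: subset_trans (IH (ltnW kl)) _.
  by have [] := incF _ kl.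
Qed.

End Charts.

(** * Specialization of roots *)

Section RootSpecialization.
Variables (K : closedFieldType) (D : nat).
Implicit Types (a : 'I_D -> K) (t : K).

Lemma family_ev_msym a t (s : 'S_D) (b : {mpoly {poly K}[D]}) :
  family_ev (a, t) (msym s b) = family_ev (a \o s, t) b.
Proof.
rewrite /= /msym {2}/mmap rmorph_sum /=; apply: eq_bigr => mm _.
rewrite rmorphM /= mmapC /=; congr (_ * _).
rewrite rmorph_prod; apply: eq_bigr => i _.
by rewrite rmorphXn /= mmapX mmap1U.
Qed.

Lemma family_ev_mesym a t k :
  family_ev (a, t) (mesym D {poly K} k) = (mesym D K k).@[a].
Proof.
rewrite /mesym !rmorph_sum /=; apply: eq_bigr => h _.
rewrite !rmorph_prod; apply: eq_bigr => i _ /=.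
by rewrite mevalXU mmapX mmap1U.
Qed.

(** A symmetric polynomial of the roots is a polynomial in the coefficients of
   [H t], hence in [t]. *)
Lemma symmetric_at_roots (b : {mpoly {poly K}[D]}) (H : K -> {poly K}) :
    b \is symmetric -> regularp (@poly_ev K) H ->
  exists q : {poly K}, forall a t,
    H t = \prod_(i < D) ('X - (a i)%:P) -> family_ev (a, t) b = q.[t].
Proof.
move=> symb rH; have [q [<- _]] := sym_fundamental symb.
pose h t (i : 'I_D) := (-1) ^+ i.+1 * (H t)`_(D - i.+1).
pose psi t := \sum_(mm <- msupp q) (q@_mm).[t] * \prod_(i < D) h t i ^+ mm i.
have [p pE] : regular (@poly_ev K) psi.
  apply: regular_sum => mm; apply: regularM; first by exists q@_mm.
  apply: regular_prod => i; apply: regularX; apply: regularM => //.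
  exact: regular_polyC.
exists p => a t Ha; rewrite -[p.[t]]/(poly_ev t p) -pE.
rewrite /= /comp_mpoly {2}/mmap rmorph_sum /=; apply: eq_bigr => mm _.
rewrite rmorphM /= mmapC /=; congr (_ * _).
rewrite rmorph_prod; apply: eq_bigr => i _.
rewrite rmorphXn /=; congr (_ ^+ _); rewrite tnth_mktuple.
rewrite -[LHS]/(family_ev (a, t) (mesym D {poly K} i.+1)) family_ev_mesym /h Ha.
have := mroots_coeff [tuple a i | i < D] (Ordinal (ltn_ord i : (i.+1 < D.+1)%N)).
rewrite big_tuple => /=.
under eq_bigr do rewrite tnth_mktuple.
move=> ->; rewrite mulrA -expr2 sqrr_sign mul1r.
by apply: meval_eq => l; rewrite tnth_mktuple.
Qed.

(** If [F] took a nonzero value [c] at [t = 0] for some ordering of the roots,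
   consider the product of [c - F] over all orderings.  It is symmetric, hence a
   polynomial in [t] alone; it equals a power of [c] for [t <> 0], so also at
   [t = 0], where however one of its factors is zero. *)
Lemma root_specialization (H : K -> {poly K}) (F : ('I_D -> K) * K -> K) :
    regularp (@poly_ev K) H ->
    (forall t, H t \is monic /\ size (H t) = D.+1) ->
    regular (@family_ev K D) F ->
    (forall a t, t != 0 -> H t = \prod_(i < D) ('X - (a i)%:P) -> F (a, t) = 0) ->
  forall a, H 0 = \prod_(i < D) ('X - (a i)%:P) -> F (a, 0) = 0.
Proof.
move=> rH monH [b bE] F0 a0 Ha0; set c := F (a0, 0).
apply/eqP; apply: contraT => c0.
pose Q := \prod_(s : 'S_D) ((c%:P)%:MP - msym s b).
have evQ a t : family_ev (a, t) Q = \prod_(s : 'S_D) (c - F (a \o s, t)).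
  rewrite rmorph_prod; apply: eq_bigr => s _; rewrite rmorphB family_ev_msym -bE.
  by rewrite /= mmapC /= /horner_eval hornerC.
have symQ : Q \is symmetric.
  apply/issymP => s; rewrite rmorph_prod [RHS](reindex_inj (mulIg s)).
  by apply: eq_bigr => s' _; rewrite msymMm rmorphB /= /msym mmapC.
have [q qE] := symmetric_at_roots symQ rH.
have split_H t : exists a, H t = \prod_(i < D) ('X - (a i)%:P).
  have [mon sz] := monH t; have [r rE] := closed_field_poly_normal (H t).
  rewrite (monicP mon) scale1r in rE.
  have szr : size r = D by move: sz; rewrite rE size_prod_XsubC => -[].
  exists (fun i => r`_i); rewrite rE -(big_mkord xpredT (fun i => 'X - (r`_i)%:P)).
  by rewrite -szr -(big_nth 0 xpredT (fun x => 'X - x%:P)).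
have perm_roots (a : 'I_D -> K) (s : 'S_D) :
    \prod_(i < D) ('X - ((a \o s) i)%:P) = \prod_(i < D) ('X - (a i)%:P).
  by rewrite [RHS](reindex_inj (@perm_inj _ s)).
have q_const : (q - (c ^+ #|{: 'S_D}|)%:P) * 'X = 0.
  apply: poly_vanish => t; rewrite hornerMX hornerD hornerN hornerC.
  have [->|t0] := eqVneq t 0; first by rewrite mulr0.
  have [a Ha] := split_H t; rewrite -(qE a t Ha) evQ.
  rewrite (eq_bigr (fun=> c)) ?prodr_const ?subrr ?mul0r // => s _.
  by rewrite F0 ?subr0 // perm_roots.
have : q.[0] = 0.
  rewrite -(qE a0 0 Ha0) evQ (bigD1 1%g) //=.
  have -> : a0 \o (1%g : 'S_D) = a0 by apply/funext => i /=; rewrite perm1.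
  by rewrite subrr mul0r.
move/eqP: q_const; rewrite mulf_eq0 polyX_eq0 orbF subr_eq0 => /eqP ->.
by rewrite hornerC => /eqP; rewrite expf_eq0 (negbTE c0) andbF.
Qed.

End RootSpecialization.

(** * Jets as triples of polynomials *)

Section JetPoints.
Variables (K : fieldType) (m : nat).

Definition arc_of (v : 'I_(3 * m.+1) -> K) (c : 'I_3) : {poly K} :=
  \poly_(k < m.+1) v (mxvec_index c (inord k)).

Definition jet_point (x y z : {poly K}) : 'I_(3 * m.+1) -> K :=
  fun i => mxvec (\matrix_(c < 3, k < m.+1) (nth 0 [:: x; y; z] c)`_k) 0 i.

Lemma jet_pointE x y z (c : nat) (k : 'I_m.+1) : (c < 3)%N ->
  jet_point x y z (mxvec_index (inord c) k) = (nth 0 [:: x; y; z] c)`_k.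
Proof. by move=> c3; rewrite /jet_point mxvecE mxE inordK. Qed.

Lemma arc_of_jet_point (x y z : {poly K}) (c : nat) : (c < 3)%N ->
  (size (nth (0%R : {poly K}) [:: x; y; z] c) <= m.+1)%N ->
  arc_of (jet_point x y z) (inord c) = nth 0 [:: x; y; z] c.
Proof.
move=> c3 sz; apply/polyP => k; rewrite coef_poly.
case: ltnP => km; first by rewrite jet_pointE // inordK.
by rewrite nth_default // (leq_trans sz).
Qed.

Lemma jet_point_arc v :
  jet_point (arc_of v (inord 0)) (arc_of v (inord 1)) (arc_of v (inord 2)) = v.
Proof.
apply/funext => i; case/mxvec_indexP: i => c k.
rewrite -(inord_val c) jet_pointE //.
have -> : nth 0 [:: arc_of v (inord 0); arc_of v (inord 1); arc_of v (inord 2)] c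
        = arc_of v (inord c) by case: c => -[|[|[|]]].
by rewrite coef_poly ltn_ord !inord_val.
Qed.

Lemma regular_jet_point (B : comNzRingType) (T : Type) (ev : T -> {rmorphism B -> K})
    (x y z : T -> {poly K}) : regularp ev x -> regularp ev y -> regularp ev z ->
  forall i, regular ev (fun t => jet_point (x t) (y t) (z t) i).
Proof.
move=> rx ry rz i; case/mxvec_indexP: i => c k; rewrite -(inord_val c).
apply: (@regular_ext _ _ _ _ (fun t => (nth 0 [:: x t; y t; z t] c)`_k)).
  by move=> t; rewrite jet_pointE.
by case: c => -[|[|[|]]].
Qed.

Lemma dvdp_XnP k (p : {poly K}) :
  reflect (forall l, (l < k)%N -> p`_l = 0) ('X^k %| p).
Proof.
apply: (iffP idP) => [/dvdpP[q ->] l lk|p0]; first by rewrite coefMXn lk.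
apply/dvdpP; exists (drop_poly k p); rewrite -{1}(poly_take_drop k p).
suff -> : take_poly k p = 0 by rewrite add0r.
by apply/polyP => l; rewrite coef_take_poly coef0; case: ltnP => // /p0.
Qed.

Variable n : nat.

Lemma jet_eq_eval (v : 'I_(3 * m.+1) -> K) k :
  (jet_eq K n m k).@[v] =
  (arc_of v (inord 0) * arc_of v (inord 1) - arc_of v (inord 2) ^+ n.+1)`_k.
Proof.
have arcE c : map_poly (meval v) (jet_arc K m c) = arc_of v c.
  apply/polyP => l; rewrite coef_map !coef_poly /=.
  by case: ifP => _; rewrite ?meval0 // mevalXU.
rewrite /jet_eq -(coef_map (meval v)) /An_poly; congr (_`_k).
rewrite rmorphB rmorphM rmorphXn /= !mmapX !mmap1U.
by rewrite rmorphB rmorphM rmorphXn /= !arcE.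
Qed.

Lemma generated_ideal_locus N (s : seq {mpoly K[N]}) (v : 'I_N -> K) :
  zero_locus (generated_ideal s) v <-> (forall p, p \in s -> p.@[v] = 0).
Proof.
split=> [vs p /(nthP 0)[i si <-]|vs _ [c ->]].
  apply: vs; exists (fun k => (k == Ordinal si)%:R).
  rewrite (bigD1 (Ordinal si)) //= eqxx mul1r big1 ?addr0 // => k /negbTE ->.
  by rewrite mul0r.
rewrite raddf_sum big1 /= // => i _.
by rewrite mevalM (vs s`_i) ?mulr0 // mem_nth.
Qed.

Lemma ZcompP l (v : 'I_(3 * m.+1) -> K) : (1 <= l)%N -> (l <= n)%N -> (n <= m)%N ->
  Zcomp n l v <->
  [/\ 'X^l %| arc_of v (inord 0), 'X^((n - l).+1) %| arc_of v (inord 1),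
      'X %| arc_of v (inord 2) &
      'X^(m.+1) %| arc_of v (inord 0) * arc_of v (inord 1) - arc_of v (inord 2) ^+ n.+1].
Proof.
move=> l0 ln nm; rewrite /Zcomp /component_ideal generated_ideal_locus.
have jet_varE (c : 'I_3) k : (k < m.+1)%N ->
    (jet_var K c (inord k : 'I_m.+1)).@[v] = (arc_of v c)`_k.
  by move=> km; rewrite mevalXU coef_poly km.
have jet_var0 (c : 'I_3) : (jet_var K c (ord0 : 'I_m.+1)).@[v] = (arc_of v c)`_0.
  by rewrite -jet_varE //; congr (meval v (jet_var K c _)); apply/val_inj; rewrite /= inordK.
have mem_gens p : (p \in component_gens K n m l) =
    [|| p \in [seq jet_var K (inord 0) (inord k : 'I_m.+1) | k <- iota 0 l],
        p \in [seq jet_var K (inord 1) (inord k : 'I_m.+1) | k <- iota 0 (n - l).+1],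
        p == jet_var K (inord 2) (ord0 : 'I_m.+1) |
        p \in [seq jet_eq K n m k | k <- iota 0 m.+1]].
  by rewrite /component_gens -[_ :: _]cat1s !mem_cat mem_seq1.
split=> [gens|[/dvdp_XnP x0 /dvdp_XnP y0 z0 /dvdp_XnP f0] p].
  split.
  - apply/dvdp_XnP => k kl; rewrite -jet_varE; last by lia.
    by apply: gens; rewrite mem_gens; apply/or4P/Or41/mapP; exists k; rewrite ?mem_iota.
  - apply/dvdp_XnP => k kl; rewrite -jet_varE; last by lia.
    by apply: gens; rewrite mem_gens; apply/or4P/Or42/mapP; exists k; rewrite ?mem_iota.
  - rewrite -['X]expr1; apply/dvdp_XnP => -[|//] _; rewrite -jet_var0.
    by apply: gens; rewrite mem_gens eqxx !orbT.
  - apply/dvdp_XnP => k km; rewrite -jet_eq_eval; apply: gens.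
    by rewrite mem_gens; apply/or4P/Or44/mapP; exists k; rewrite ?mem_iota.
rewrite mem_gens => /or4P[/mapP[k]|/mapP[k]|/eqP ->|/mapP[k]].
- by rewrite mem_iota => /andP[_ kl] ->; rewrite jet_varE ?x0 //; lia.
- by rewrite mem_iota => /andP[_ kl] ->; rewrite jet_varE ?y0 //; lia.
- rewrite jet_var0; move: z0; rewrite -{1}['X]expr1 => /dvdp_XnP; exact.
- by rewrite mem_iota => /andP[_ km] ->; rewrite jet_eq_eval f0.
Qed.

Lemma size_arc_of v c : (size (arc_of v c) <= m.+1)%N.
Proof. exact: size_poly. Qed.

(** With [b = n - i + 1], the equations of the intersection of [Z^i] and [Z^j]
   for [i < j]: of the two conditions on each of x and y the stronger remains. *)
Definition jet_condition j b (x y z : {poly K}) :=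
  [/\ 'X^j %| x, 'X^b %| y, 'X %| z & 'X^(m.+1) %| x * y - z ^+ n.+1].

Lemma Zcomp_interP i j (v : 'I_(3 * m.+1) -> K) :
  (1 <= i)%N -> (i < j)%N -> (j <= n)%N -> (n <= m)%N ->
  (Zcomp n i `&` Zcomp n j) v <->
  jet_condition j (n - i).+1 (arc_of v (inord 0)) (arc_of v (inord 1)) (arc_of v (inord 2)).
Proof.
move=> i0 ij jn nm; have j0 : (1 <= j)%N by apply: leq_ltn_trans ij.
have iN : (i <= n)%N by apply: leq_trans jn; apply: ltnW.
split=> [[/(ZcompP _ i0 iN nm)[_ y0 z0 f0] /(ZcompP _ j0 jn nm)[x0 _ _ _]]|].
  by [].
move=> [x0 y0 z0 f0]; split; apply/ZcompP => //; split=> //.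
  by apply: dvdp_trans x0; rewrite dvdp_exp2l // ltnW.
by apply: dvdp_trans y0; rewrite dvdp_exp2l // ltnS leq_sub2l // ltnW.
Qed.

Lemma zariski_closed_Zcomp l : zariski_closed (@Zcomp K n m l).
Proof. by exists (component_ideal n l). Qed.

End JetPoints.

(** * Slices of the parameter space, and the linear case *)

Section Segments.
Variables (K : closedFieldType) (d : nat).
Implicit Types (s : 'I_d -> K).

(** Coordinates indexed by all integers, so that slices of the parameter space
   need no casts between ordinal types. *)
Definition padded s k : K := if insub k is Some i then s i else 0.

Definition slice s o l : {poly K} := \poly_(k < l) padded s (o + k).

Lemma padded_val s (i : 'I_d) : padded s i = s i.
Proof. by rewrite /padded valK. Qed.

Lemma padded_fun (f : nat -> K) k : (k < d)%N -> padded (fun i => f i) k = f k.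
Proof. by move=> kd; rewrite (padded_val _ (Ordinal kd)). Qed.

Lemma regular_padded k : regular (@mpoly_ev K d) (fun s => padded s k).
Proof.
rewrite /padded; case: insub => [i|]; first exact: regular_mpolyX.
exact: regular0.
Qed.

Lemma regularp_slice o l : regularp (@mpoly_ev K d) (fun s => slice s o l).
Proof.
by apply: regularp_poly => k; apply: regular_padded.
Qed.

Lemma size_slice s o l : (size (slice s o l) <= l)%N.
Proof. exact: size_poly. Qed.

Lemma coef_slice s o l k : (k < l)%N -> (slice s o l)`_k = padded s (o + k).
Proof. by move=> kl; rewrite coef_poly kl. Qed.

Lemma slice_fun (f : nat -> K) o l (p : {poly K}) : (size p <= l)%N -> (o + l <= d)%N ->
  (forall k, (k < l)%N -> f (o + k)%N = p`_k) -> slice (fun i => f i) o l = p.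
Proof.
move=> szp old fp; apply/polyP => k; rewrite coef_poly.
case: ltnP => kl; last by rewrite nth_default // (leq_trans szp).
by rewrite padded_fun ?fp //; lia.
Qed.

End Segments.

Lemma dvdp_Xn_drop (F : fieldType) k (p : {poly F}) : 'X^k %| p ->
  p = drop_poly k p * 'X^k.
Proof.
move=> /dvdp_XnP p0; rewrite -{1}(poly_take_drop k p).
suff -> : take_poly k p = 0 by rewrite add0r.
by apply/polyP => l; rewrite coef_take_poly coef0; case: ltnP => // /p0.
Qed.

Section LinearCase.
Variables (K : closedFieldType) (m j b k : nat).
Hypotheses (jm : (j <= m.+1)%N) (bm : (b <= m.+1)%N) (km : (k <= m.+1)%N).

Let A := (m.+1 - j)%N.
Let B := (m.+1 - b)%N.
Let C := (m.+1 - k)%N.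
Let d := (A + B + C)%N.

Definition linear_chart (s : 'I_d -> K) : 'I_(3 * m.+1) -> K :=
  jet_point (slice s 0 A * 'X^j) (slice s A B * 'X^b) (slice s (A + B) C * 'X^k).

Lemma linear_dim (Z : set ('I_(3 * m.+1) -> K)) :
    zariski_closed Z ->
    (forall v, Z v <-> [/\ 'X^j %| arc_of v (inord 0), 'X^b %| arc_of v (inord 1) &
                           'X^k %| arc_of v (inord 2)]) ->
  pure_dimensional Z /\ has_dim Z d.
Proof.
move=> clZ ZE.
have szX l (p : {poly K}) : (l <= m.+1)%N -> (size p <= m.+1 - l)%N ->
    (size (p * 'X^l)%R <= m.+1)%N.
  move=> lm sp; apply: leq_trans (size_polyMleq _ _) _; rewrite size_polyXn; lia.
apply: (@dim_of_charts _ _ _ _ 0%N (fun=> linear_chart)) => //.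
- move=> _; apply: regular_jet_point => q; apply: regularpM;
    by [apply: regularp_slice | apply: regularpC; apply: regular_mpolyC].
- move=> _ _; exists (fun=> 0), (fun i : 'I_d =>
    if (i < A)%N then mxvec_index (inord 0) (inord (j + i))
    else if (i < A + B)%N then mxvec_index (inord 1) (inord (b + (i - A)))
    else mxvec_index (inord 2) (inord (k + (i - (A + B))))).
  set iota := (X in forall i, (forall s, _ -> _ (X i) = _) /\ _).
  have chartE s i : linear_chart s (iota i) = s i.
    rewrite -(padded_val s) /linear_chart /iota.
    case: (ltnP i A) => iA.
      rewrite jet_pointE // /= inordK ?coefMXn; last by rewrite /A in iA; lia.
      by rewrite ltnNge leq_addr /= addKn coef_slice.
    case: (ltnP i (A + B)) => iB.
      rewrite jet_pointE // /= inordK ?coefMXn; last by rewrite /A /B in iA iB; lia.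
      by rewrite ltnNge leq_addr /= addKn coef_slice ?subnKC //; lia.
    have id : (i < A + B + C)%N by exact: ltn_ord.
    rewrite jet_pointE // /= inordK ?coefMXn; last by rewrite /A /B /C in iB id *; lia.
    by rewrite ltnNge leq_addr /= addKn coef_slice ?subnKC //; lia.
  move=> i; split=> [s|]; first by rewrite chartE.
  exists (fun l => (l == i)%:R); split=> [l il|]; first by rewrite -val_eqE /= gtn_eqF.
  by rewrite chartE eqxx oner_eq0.
- move=> _ s _; apply/ZE; rewrite !arc_of_jet_point //=; last 3 first.
  + by apply: szX => //; apply: size_slice.
  + by apply: szX => //; apply: size_slice.
  + by apply: szX => //; apply: size_slice.
  by split; apply: dvdp_mull.
move=> v /ZE[x0 y0 z0]; exists 0%N => //; apply: sub_zclosure.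
pose f l := if (l < A)%N then (drop_poly j (arc_of v (inord 0)))`_l
  else if (l < A + B)%N then (drop_poly b (arc_of v (inord 1)))`_(l - A)
  else (drop_poly k (arc_of v (inord 2)))`_(l - (A + B)).
exists (fun i => f i) => //; rewrite -[RHS]jet_point_arc /linear_chart.
have sz l c : (size (drop_poly l (arc_of v c)) <= m.+1 - l)%N.
  by rewrite size_drop_poly leq_sub2r // size_arc_of.
rewrite (slice_fun (p := drop_poly j (arc_of v (inord 0)))) ?sz //; last 2 first.
- by rewrite /d; lia.
- by move=> l lA; rewrite /f lA.
rewrite (slice_fun (p := drop_poly b (arc_of v (inord 1)))) ?sz //; last 2 first.
- by rewrite /d; lia.
- by move=> l lB; rewrite /f ltnNge leq_addr /= ltn_add2l lB addKn.
rewrite (slice_fun (p := drop_poly k (arc_of v (inord 2)))) ?sz //; last first.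
  move=> l lC; rewrite /f.
  rewrite ltnNge -addnA leq_addr /= ltn_add2l ltnNge leq_addr /=.
  by rewrite addnA addKn.
by rewrite -!dvdp_Xn_drop.
Qed.

End LinearCase.

(** * Congruences modulo powers of t *)

Section Congruences.
Variable K : fieldType.
Implicit Types (p q r : {poly K}).

Definition eqX k p q := 'X^k %| p - q.

Lemma eqX_refl k p : eqX k p p.
Proof. by rewrite /eqX subrr dvdp0. Qed.

Lemma eqX_sym k p q : eqX k p q -> eqX k q p.
Proof. by rewrite /eqX -opprB dvdpNr. Qed.

Lemma eqX_trans k p q r : eqX k p q -> eqX k q r -> eqX k p r.
Proof. by move=> pq qr; rewrite /eqX -(subrKA q) dvdp_add. Qed.

Lemma eqXM k p q p' q' : eqX k p q -> eqX k p' q' -> eqX k (p * p') (q * q').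
Proof.
move=> pq pq'; rewrite /eqX.
have -> : p * p' - q * q' = (p - q) * p' + q * (p' - q') by ring.
by apply: dvdp_add; [apply: dvdp_mulr | apply: dvdp_mull].
Qed.

Lemma eqXMl k p p' q' : eqX k p' q' -> eqX k (p * p') (p * q').
Proof. exact: eqXM (eqX_refl k p). Qed.

Lemma eqX_leq k l p q : (k <= l)%N -> eqX l p q -> eqX k p q.
Proof. by move=> kl; apply: dvdp_trans; rewrite dvdp_exp2l. Qed.

Lemma eqX_shift k l p q : eqX (l + k) ('X^l * p) ('X^l * q) = eqX k p q.
Proof. by rewrite /eqX -mulrBr exprD dvdp_mul2l // expf_neq0 ?polyX_eq0. Qed.

Lemma eqX_take k l p : (k <= l)%N -> eqX k (take_poly l p) p.
Proof.
move=> kl; apply: eqX_leq kl _; rewrite /eqX -{2}(poly_take_drop l p).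
by rewrite opprD addNKr dvdpNr dvdp_mull.
Qed.

Lemma eqX_take_eq k p q : eqX k p q -> take_poly k p = take_poly k q.
Proof.
move=> /dvdp_XnP pq; apply/polyP => l; rewrite !coef_take_poly.
by case: ltnP => // /pq /eqP; rewrite coefB subr_eq0 => /eqP.
Qed.

Lemma eqX_addr k l p q : (k <= l)%N -> eqX k (p + q * 'X^l) p.
Proof.
by move=> kl; rewrite /eqX addrC addrA addNr add0r dvdp_mull // dvdp_exp2l.
Qed.

(** The expansion of the inverse of [1 + q], truncated so as to be a polynomial. *)
Definition geom k q := \sum_(l < k) (- q) ^+ l.

Lemma geomE k q : (1 + q) * geom k q = 1 - (- q) ^+ k.
Proof. by rewrite -opprB subrX1 /geom -mulNr opprB opprK. Qed.

Lemma eqX_geom k p : eqX k ((1 + p * 'X) * geom k (p * 'X)) 1.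
Proof.
by rewrite geomE /eqX addrC addKr dvdpNr -mulNr exprMn dvdp_mull.
Qed.

Lemma split_unit (u : {poly K}) : u`_0 != 0 ->
  u = (u`_0)%:P * (1 + drop_poly 1 ((u`_0)^-1 *: u) * 'X).
Proof.
move=> u0; rewrite -[u in LHS](scalerKV u0) -mul_polyC; congr (_ * _).
rewrite -{1}(poly_take_drop 1 ((u`_0)^-1 *: u)) expr1; congr (_ + _).
apply/polyP => -[|l]; rewrite coef_take_poly coef1 //=.
by rewrite coefZ mulVf.
Qed.

Lemma inverse_modXn k (u : {poly K}) : u`_0 != 0 -> exists v, eqX k (u * v) 1.
Proof.
move=> u0; pose p := drop_poly 1 ((u`_0)^-1 *: u).
exists ((u`_0)^-1%:P * geom k (p * 'X)).
have -> : u * ((u`_0)^-1%:P * geom k (p * 'X)) = (1 + p * 'X) * geom k (p * 'X).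
  rewrite {1}(split_unit u0) -/p mulrACA -polyCM mulfV // mul1r //.
exact: eqX_geom.
Qed.

Lemma coef0_dvdXn k (u : {poly K}) : (0 < k)%N -> 'X^k %| u -> u`_0 = 0.
Proof. by move=> k0 /dvdp_XnP ->. Qed.

(** A truncated series is only known to have an order when this order is at most
   [k]. *)
Lemma order_cases k (u : {poly K}) : 'X^(k.+1) %| u \/
  exists a, [/\ (a <= k)%N, u = 'X^a * drop_poly a u & (drop_poly a u)`_0 != 0].
Proof.
have [] := boolP [exists a : 'I_k.+1, u`_a != 0]; last first.
  rewrite negb_exists => /forallP u0; left; apply/dvdp_XnP => l lk.
  by have := u0 (Ordinal lk); rewrite negbK => /eqP.
move=> /existsP[a0 ua0]; right.
have ex : exists a, (a <= k)%N && (u`_a != 0).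
  by exists a0; rewrite ua0 -ltnS ltn_ord.
case: (ex_minnP ex) => a /andP[ak ua] amin.
have Xu : 'X^a %| u.
  apply/dvdp_XnP => l la; apply/eqP; apply: contraLR la => ul; rewrite -leqNgt.
  have [lk|kl] := leqP l k; first by apply: amin; rewrite lk ul.
  by apply: leq_trans ak (ltnW kl).
by exists a; split; rewrite ?coef_drop_poly // mulrC -dvdp_Xn_drop.
Qed.

End Congruences.

(** * The case of several components *)

(** The coefficient of [t ^ n.+1] in [x * y] is zero, and in [z ^ n.+1] it is the
   [n.+1]-st power of the coefficient of [t] in [z]. *)
Lemma jet_condition_X2 (K : fieldType) (m n j b : nat) (x y z : {poly K}) :
  (n < m)%N -> (n.+1 < j + b)%N -> jet_condition m n j b x y z -> 'X^2 %| z.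
Proof.
move=> nm jbn [x0 y0 z0 f0].
move: z0; rewrite -{1}['X]expr1 => /dvdp_Xn_drop; set w := drop_poly 1 z => zE.
have z1 : 'X^(n.+2) %| z ^+ n.+1.
  have -> : z ^+ n.+1 = x * y - (x * y - z ^+ n.+1) by ring.
  apply: dvdp_sub; last by apply: dvdp_trans f0; rewrite dvdp_exp2l.
  by apply: (dvdp_trans (dvdp_exp2l 'X jbn)); rewrite exprD dvdp_mul.
have w0 : w`_0 = 0.
  have : 'X^1 %| w ^+ n.+1.
    move: z1; rewrite zE exprMn expr1 -addn1 exprD mulrC expr1.
    by rewrite dvdp_mul2r ?expf_neq0 ?polyX_eq0 // expr1.
  move=> /(coef0_dvdXn (ltn0Sn 0))/eqP.
  by rewrite -horner_coef0 horner_exp expf_eq0 /= horner_coef0 => /eqP.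
rewrite zE exprS expr1; apply: dvdp_mul => //.
by rewrite -['X]expr1; apply/dvdp_XnP => -[].
Qed.

Section ToricCase.
Variables (K : closedFieldType) (n m j b e N : nat).
Hypotheses (nm : (n < m)%N) (b0 : (0 < b)%N).
Hypotheses (jbN : (j + b + N = m.+1)%N) (jbe : (j + b + e = 2 * n.+1)%N).

Let d := (2 * m)%N.

Definition divided_jet (u v w : {poly K}) : 'I_(3 * m.+1) -> K :=
  jet_point (u * 'X^j) (v * 'X^b) (w * 'X^2).

Definition divided_eq (u v w : {poly K}) := eqX N (u * v) ('X^e * w ^+ n.+1).

(** Both sides of the equation of the jets are divisible by
   [t ^ (j + b)], since [j + b + e = 2 * n.+1]. *)
Lemma divided_condition u v w :
  jet_condition m n j b (u * 'X^j) (v * 'X^b) (w * 'X^2) <-> divided_eq u v w.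
Proof.
have E : u * 'X^j * (v * 'X^b) - (w * 'X^2) ^+ n.+1 =
    'X^(j + b) * (u * v - 'X^e * w ^+ n.+1).
  by rewrite exprMn -exprM -jbe !exprD; ring.
rewrite /jet_condition /divided_eq /eqX E -jbN exprD.
rewrite dvdp_mul2l ?expf_neq0 ?polyX_eq0 //.
split=> [[]|] // H; split=> //; try exact: dvdp_mulIr.
by apply: dvdp_mull; rewrite -{1}['X]expr1 dvdp_exp2l.
Qed.

Section Chart.
Variable a : nat.

Definition chart_lead (s : 'I_d -> K) : {poly K} := (padded s 0)%:P.
Definition chart_tail (s : 'I_d -> K) := slice s 1 (b + N - a - 1).
Definition chart_root (s : 'I_d -> K) := slice s (b + N - a) m.-1.
Definition chart_free (s : 'I_d -> K) := slice s (b + N - a + m.-1) (j + a).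

(** For [u = t ^ a * sigma * (1 + t p)] and [w] replaced by [sigma * w], the
   equation determines [v] modulo [t ^ (N - a)]; the higher coefficients are
   free.  The factor [sigma] in front of [w] cancels the inverse of [sigma], so
   that the parametrisation is polynomial. *)
Definition chart_v (sigma p w r : {poly K}) : {poly K} :=
  take_poly (N - a) ('X^(e - a) * (sigma ^+ n * w ^+ n.+1 * geom m.+1 (p * 'X)))
  + r * 'X^(N - a).

Definition chart (s : 'I_d -> K) : 'I_(3 * m.+1) -> K :=
  divided_jet ('X^a * (chart_lead s * (1 + chart_tail s * 'X)))
    (chart_v (chart_lead s) (chart_tail s) (chart_root s) (chart_free s))
    (chart_lead s * chart_root s).

Lemma polynomial_map_chart : polynomial_map chart.
Proof.
have rC := regular_mpolyC (K := K) d.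
have rlead : regularp (@mpoly_ev K d) chart_lead.
  by apply: regularp_polyC; apply: regular_padded.
have rtail : regularp (@mpoly_ev K d) chart_tail by exact: regularp_slice.
have rroot : regularp (@mpoly_ev K d) chart_root by exact: regularp_slice.
have rfree : regularp (@mpoly_ev K d) chart_free by exact: regularp_slice.
have rX : regularp (@mpoly_ev K d) (fun=> 'X) by exact: regularpC.
have rXn k : regularp (@mpoly_ev K d) (fun=> 'X^k) by exact: regularpC.
have r1 : regularp (@mpoly_ev K d) (fun=> 1) by exact: regularpC.
apply: regular_jet_point.
- apply: regularpM => //; apply: regularpM => //; apply: regularpM => //.
  by apply: regularpD => //; apply: regularpM.
- apply: regularpM => //; apply: regularpD; last exact: regularpM.
  apply: regularp_take; apply: regularpM => //; apply: regularpM.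
    by apply: regularpM; apply: regularpX.
  apply: regularp_sum => // k; apply: regularpX => //; apply: regularpN.
  exact: regularpM.
- by apply: regularpM => //; apply: regularpM.
Qed.

Hypotheses (aN : (a <= N)%N) (ae : (a <= e)%N).

Lemma chart_divided_eq (sigma p w r : {poly K}) :
  divided_eq ('X^a * (sigma * (1 + p * 'X))) (chart_v sigma p w r) (sigma * w).
Proof.
rewrite /divided_eq -(subnKC aN) -(subnKC ae) exprD -!mulrA eqX_shift.
pose g := sigma ^+ n * w ^+ n.+1 * geom m.+1 (p * 'X).
apply: (@eqX_trans _ _ _ (sigma * ((1 + p * 'X) * ('X^(e - a) * g)))).
  do 2 apply: eqXMl; apply: eqX_trans (eqX_addr _ _ (leqnn _)) _.
  exact: eqX_take.
have -> : sigma * ((1 + p * 'X) * ('X^(e - a) * g)) =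
    'X^(e - a) * (sigma * w) ^+ n.+1 * ((1 + p * 'X) * geom m.+1 (p * 'X)).
  by rewrite /g exprMn (exprS sigma); ring.
rewrite -[X in eqX _ _ X]mulr1; apply: eqXMl.
by apply: eqX_leq (eqX_geom _ _); lia.
Qed.

Lemma chart_sizes s :
  [/\ (size ('X^a * (chart_lead s * (1 + chart_tail s * 'X)))%R <= b + N)%N,
      (size (chart_v (chart_lead s) (chart_tail s) (chart_root s) (chart_free s))
         <= j + N)%N &
      (size (chart_lead s * chart_root s)%R <= m.-1)%N].
Proof.
have szC c (p : {poly K}) k : (size p <= k)%N -> (size (c%:P * p)%R <= k)%N.
  by move=> pk; rewrite mul_polyC (leq_trans (size_scale_leq _ _)).
have szM k (p : {poly K}) l : (size p <= l)%N -> (size (p * 'X^k)%R <= l + k)%N.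
  by move=> pl; apply: leq_trans (size_polyMleq _ _) _; rewrite size_polyXn; lia.
split.
- rewrite mulrC; apply: (@leq_trans (b + N - a + a)); last by lia.
  apply/szM/szC; apply: leq_trans (size_polyD _ _) _.
  rewrite geq_max size_poly1 -['X]expr1; apply/andP; split; first by lia.
  apply: (@leq_trans (b + N - a - 1 + 1)); last by lia.
  exact/szM/size_slice.
- apply: leq_trans (size_polyD _ _) _; rewrite geq_max; apply/andP; split.
    by apply: leq_trans (size_take_poly _ _) _; lia.
  apply: (@leq_trans (j + a + (N - a))); last by lia.
  exact/szM/size_slice.
- exact/szC/size_slice.
Qed.

(** Along the flag through the point with [sigma = 1] and all other parameters 0,
   each parameter is, up to a factor [sigma], one coordinate of the jet. *)
Lemma chart_flag : flag_chart chart.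
Proof.
pose iota (i : 'I_d) : 'I_(3 * m.+1) :=
  if (i < b + N - a)%N then mxvec_index (inord 0) (inord (j + a + i))
  else if (i < b + N - a + m.-1)%N then mxvec_index (inord 2) (inord (2 + (i - (b + N - a))))
  else mxvec_index (inord 1) (inord (b + (N - a) + (i - (b + N - a + m.-1)))).
have chartE s i : chart s (iota i) =
    (if (0 < i)%N && (i < b + N - a + m.-1)%N then padded s 0 else 1) * s i.
  rewrite -(padded_val s) /chart /divided_jet /iota.
  have id : (i < 2 * m)%N by exact: ltn_ord.
  case: (ltnP i (b + N - a)) => iA.
    have -> : (i < b + N - a + m.-1)%N by lia.
    rewrite andbT jet_pointE // /= inordK ?coefMXn; last by lia.
    rewrite -addnA ltnNge leq_addr /= addKn coefXnM ltnNge leq_addr /= addKn.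
    rewrite coefCM coefD coefMX coef1; case: (val i) iA => [|k] iA /=.
      by rewrite addr0 mulr1 mul1r.
    by rewrite add0r coef_slice ?add1n //; lia.
  have -> : (0 < i)%N by lia.
  case: (ltnP i (b + N - a + m.-1)) => iB /=.
    rewrite jet_pointE // /= inordK ?coefMXn; last by lia.
    by rewrite ltnNge leq_addr /= addKn coefCM coef_slice ?subnKC //; lia.
  rewrite jet_pointE // /= inordK ?coefMXn; last by lia.
  rewrite -addnA ltnNge leq_addr /= addKn coefD coef_take_poly.
  rewrite ltnNge leq_addr /= add0r coefMXn ltnNge leq_addr /= addKn.
  by rewrite mul1r coef_slice ?subnKC //; lia.
exists (fun i => (i == 0 :> nat)%:R), iota => i; split=> [s si|].
  by rewrite chartE si; case: (val i) => [|k] /=; rewrite ?mulr0 ?mulr1.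
have [i0|i0] := posnP i.
  exists (fun=> 0); split=> [l il|]; first by case: (val l) il => //; lia.
  by rewrite chartE mulr0 /= eq_sym oner_eq0.
exists (fun l => ((l == 0 :> nat) || (l == i))%:R); split=> [l il|].
  by rewrite (gtn_eqF il) orbF.
rewrite chartE i0 /= eqxx orbT mulr1.
case: ifP => _; last exact: oner_neq0.
have d0 : (0 < d)%N by rewrite /d; lia.
by rewrite (padded_val _ (Ordinal d0)) /= oner_neq0.
Qed.

(** With [sigma] the leading coefficient of [u], here of order exactly [a], the
   other parameters are recovered by division by [sigma]. *)
Lemma chart_covers (U v w : {poly K}) : (size U <= b + N - a)%N -> (size v <= j + N)%N ->
    (size w <= m.-1)%N -> U`_0 != 0 -> divided_eq ('X^a * U) v w ->
  range chart (divided_jet ('X^a * U) v w).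
Proof.
move=> szU szv szw U0 eq_uvw.
pose sigma := U`_0; pose p := drop_poly 1 (sigma^-1 *: U).
pose w' : {poly K} := sigma^-1 *: w; pose r := drop_poly (N - a) v.
pose f (l : nat) := if l == 0%N then sigma else if (l < b + N - a)%N then p`_(l - 1)
  else if (l < b + N - a + m.-1)%N then w'`_(l - (b + N - a))
  else r`_(l - (b + N - a + m.-1)).
have Ew : sigma%:P * w' = w by rewrite mul_polyC /w' scalerKV.
have EU : sigma%:P * (1 + p * 'X) = U by rewrite -split_unit.
exists (fun i : 'I_d => f i) => //; rewrite /chart.
have -> : chart_lead (fun i : 'I_d => f i) = sigma%:P by rewrite /chart_lead padded_fun // /d; lia.
have -> : chart_tail (fun i : 'I_d => f i) = p.
  apply: slice_fun; last by move=> k kl; rewrite /f /= add1n subn1 /= ifT //; lia.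
    rewrite size_drop_poly; apply: leq_sub2r.
    exact: leq_trans (size_scale_leq _ _) szU.
  by rewrite /d; lia.
have -> : chart_root (fun i : 'I_d => f i) = w'.
  apply: slice_fun; first exact: leq_trans (size_scale_leq _ _) szw.
    by rewrite /d; lia.
  move=> k kl; rewrite /f addn_eq0 ltn_add2l kl addKn ltnNge leq_addr /=.
  by rewrite ifN //; lia.
have -> : chart_free (fun i : 'I_d => f i) = r.
  apply: slice_fun; first by rewrite size_drop_poly; lia.
    by rewrite /d; lia.
  move=> k kl; by rewrite /f addKn !ifN //; lia.
rewrite EU Ew; congr divided_jet; rewrite /chart_v -[RHS](poly_take_drop (N - a)).
congr (_ + _); apply: eqX_take_eq.
have eqUv : eqX (N - a) (U * v) ('X^(e - a) * w ^+ n.+1).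
  move: eq_uvw; rewrite /divided_eq -{1}(subnKC aN) -{1}(subnKC ae) exprD -!mulrA.
  by rewrite eqX_shift.
have inv : eqX (N - a) ((1 + p * 'X) * geom m.+1 (p * 'X)) 1.
  by apply: eqX_leq (eqX_geom _ _); lia.
apply: (@eqX_trans _ _ _ (((1 + p * 'X) * geom m.+1 (p * 'X)) * v)); last first.
  by rewrite -[X in eqX _ _ X]mul1r; apply: eqXM inv (eqX_refl _ _).
pose g := geom m.+1 (p * 'X) * (sigma^-1)%:P.
have sigmaK : (sigma^-1)%:P * sigma%:P = 1 :> {poly K} by rewrite -polyCM mulVf.
have -> : (1 + p * 'X) * geom m.+1 (p * 'X) * v = g * (U * v).
  by rewrite -EU -[LHS]mul1r -sigmaK /g; ring.
have -> : 'X^(e - a) * (sigma%:P ^+ n * w' ^+ n.+1 * geom m.+1 (p * 'X)) =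
    g * ('X^(e - a) * w ^+ n.+1).
  by rewrite -Ew exprMn (exprS sigma%:P) -[LHS]mul1r -sigmaK /g; ring.
exact: eqXMl (eqX_sym eqUv).
Qed.

End Chart.

(** Here [t] is the parameter of the deformation and ['X] the variable of the
   series.  With [k = alpha - e], the polynomial [H t] deforms ['X^k * U * v] by
   adding [(w + t) ^ n.+1 - w ^ n.+1], so that it remains congruent to
   [(w + t) ^ n.+1] while its constant term becomes [t ^ n.+1].  A high power of
   ['X] is added to make it monic of constant degree; this changes [v] only in
   degrees that are cut off.  Any splitting of [H t] into [k] roots and the
   other ones yields, for [t != 0], a jet with first series of order exactly
   [e], and for [t = 0] a suitable ordering yields the given jet. *)
Lemma high_order_in_closure alpha (U v w : {poly K}) :
    (e < alpha)%N -> (alpha <= N)%N -> U`_0 != 0 ->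
    (size U <= b + N - alpha)%N -> (size v <= j + N)%N -> (size w <= m.-1)%N ->
    divided_eq ('X^alpha * U) v w ->
  image_closure (chart e) (divided_jet ('X^alpha * U) v w).
Proof.
move=> ea aN U0 szU szv szw eq_uvw.
(* Division by the unit U is only possible modulo a power of t; m + 1 exceeds
   the number of coefficients of v. *)
have [I UI] := inverse_modXn m.+1 U0.
pose k := (alpha - e)%N; pose L := (m.+1 + size (U * v)%R + size w * n.+1 + 1)%N.
have eq_k : eqX (N - e) ('X^k * (U * v)) (w ^+ n.+1).
  move: eq_uvw; rewrite /divided_eq -(subnKC (ltnW ea)) -/k exprD -!mulrA.
  have {1}-> : N = (e + (N - e))%N by lia.
  by rewrite eqX_shift.
have w0 : w.[0] = 0.
  have : ('X^k * (U * v) - w ^+ n.+1)`_0 = 0 by apply: coef0_dvdXn eq_k; lia.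
  rewrite -horner_coef0 hornerD hornerN hornerM !horner_exp hornerX expr0n.
  have -> : (k == 0)%N = false by apply/negbTE; rewrite -lt0n subn_gt0.
  by rewrite mul0r sub0r => /eqP; rewrite oppr_eq0 expf_eq0 /= => /eqP.
pose low t := 'X^k * (U * v) + ((w + t%:P) ^+ n.+1 - w ^+ n.+1).
pose H t := 'X^(k + L) + low t.
have szpow t : (size ((w + t%:P) ^+ n.+1)%R <= L)%N.
  apply: leq_trans (size_poly_exp_leq _ _) _.
  have := size_polyD w t%:P; have := size_polyC_leq1 t; rewrite /L; nia.
have size_low t : (size (low t) < size ('X^(k + L) : {poly K}))%N.
  rewrite size_polyXn ltnS; apply: leq_trans (size_polyD _ _) _.
  rewrite geq_max; apply/andP; split.
    apply: leq_trans (size_polyMleq _ _) _; rewrite size_polyXn /L; lia.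
  apply: leq_trans (size_polyD _ _) _; rewrite size_polyN geq_max.
  apply/andP; split; first by apply: leq_trans (szpow t) _; apply: leq_addl.
  by have := szpow 0; rewrite addr0 => /leq_trans; apply; apply: leq_addl.
have monH t : H t \is monic /\ size (H t) = (k + L).+1.
  by rewrite monicE lead_coefDl // lead_coefXn size_polyDl // size_polyXn.
have H0 : H 0 = 'X^k * ('X^L + U * v) by rewrite /H /low addr0 subrr addr0 exprD mulrDr.
have eqH t : eqX (N - e) (H t) ((w + t%:P) ^+ n.+1).
  rewrite /eqX; have -> : H t - (w + t%:P) ^+ n.+1 =
      ('X^k * (U * v) - w ^+ n.+1) + 'X^(k + L).
    rewrite /H /low.
    by move: 'X^(k + L) ('X^k * _) (w ^+ _) ((w + _) ^+ _) => x1 x2 x3 x4; ring.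
  by apply: dvdp_add; [exact: eq_k | apply: dvdp_exp2l; lia].
have lead_t t : (H t).[0] = t ^+ n.+1.
  rewrite /H /low !hornerD hornerN hornerM !horner_exp hornerD hornerX hornerC w0.
  have -> : 0 ^+ (k + L) = 0 :> K by rewrite expr0n; case: eqP => //; lia.
  have -> : 0 ^+ k = 0 :> K by rewrite expr0n; case: eqP => //; lia.
  by rewrite expr0n /= subr0 add0r mul0r !add0r.
pose P (a : 'I_(k + L) -> K) := \prod_(i < k) ('X - (a (lshift L i))%:P).
pose Q (a : 'I_(k + L) -> K) := \prod_(i < L) ('X - (a (rshift k i))%:P).
have PQ a : \prod_(i < k + L) ('X - (a i)%:P) = P a * Q a by rewrite big_split_ord.
pose point (p : ('I_(k + L) -> K) * K) : 'I_(3 * m.+1) -> K :=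
  divided_jet ('X^e * take_poly (b + N - e) (P p.1 * U))
    (take_poly (j + N) (Q p.1 * I)) (w + p.2%:P).
have rpoint i : regular (@family_ev K (k + L)) (fun p => point p i).
  have rC := regular_familyC (K := K) (k + L).
  have rpC q : regularp (@family_ev K (k + L)) (fun=> q) by exact: regularpC.
  have rlin i' : regularp (@family_ev K (k + L)) (fun p => 'X - (p.1 i')%:P).
    apply: regularpD => //; apply: regularpN; apply: regularp_polyC.
    exact: regular_family_root.
  apply: regular_jet_point.
  - apply: regularpM => //; apply: regularpM => //; apply: regularp_take.
    by apply: regularpM => //; apply: regularp_prod.
  - apply: regularpM => //; apply: regularp_take.
    by apply: regularpM => //; apply: regularp_prod.
  - apply: regularpM => //; apply: regularpD => //; apply: regularp_polyC.
    exact: regular_family_param.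
have in_chart a t : t != 0 -> H t = \prod_(i < k + L) ('X - (a i)%:P) ->
    range (chart e) (point (a, t)).
  move=> t0; rewrite PQ => HPQ; apply: chart_covers; rewrite ?size_take_poly //.
  - lia.
  - apply: leq_trans (size_polyD _ _) _; rewrite geq_max szw.
    by apply: leq_trans (size_polyC_leq1 _) _; lia.
  - rewrite coef_take_poly ifT; last by lia.
    rewrite -horner_coef0 hornerM mulf_neq0 // ?horner_coef0 //.
    rewrite -horner_coef0; apply: contraTneq t0 => P0; rewrite negbK.
    have /eqP := lead_t t; rewrite HPQ hornerM P0 mul0r eq_sym expf_eq0 /=.
    by [].
  rewrite /divided_eq; have {1}-> : N = (e + (N - e))%N by lia.
  rewrite -mulrA eqX_shift.
  apply: eqX_trans (eqH t).
  apply: (@eqX_trans _ _ _ (P a * U * (Q a * I))).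
    by apply: eqXM; apply: eqX_take; lia.
  have -> : P a * U * (Q a * I) = P a * Q a * (U * I) by ring.
  rewrite HPQ -[X in eqX _ _ X]mulr1; apply: eqXMl.
  by apply: eqX_leq UI; lia.
have [r rE] := closed_field_poly_normal ('X^L + U * v).
have szUv : (size (U * v)%R < size ('X^L : {poly K}))%N by rewrite size_polyXn /L; lia.
rewrite lead_coefDl // lead_coefXn scale1r in rE.
have szr : size r = L.
  by have := congr1 (fun p : {poly K} => size p) rE;
    rewrite size_prod_XsubC size_polyDl // size_polyXn => -[].
(* The ordering of the roots of H 0 for which P specializes to 'X^k. *)
pose a0 i := match split i : 'I_k + 'I_L with inl _ => 0 | inr i => r`_i end.
have Pa0 : P a0 = 'X^k.
  rewrite /P (eq_bigr (fun=> 'X)) ?prodr_const ?card_ord // => i _.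
  by rewrite /a0 (unsplitK (inl _ i)) subr0.
have Qa0 : Q a0 = 'X^L + U * v.
  rewrite rE /Q (eq_bigr (fun i : 'I_L => 'X - (r`_i)%:P)) => [|i _].
    rewrite -(big_mkord xpredT (fun i => 'X - (r`_i)%:P)).
    by rewrite -szr -(big_nth 0 xpredT (fun x => 'X - x%:P)).
  by rewrite /a0 (unsplitK (inr _ i)).
have point0 : point (a0, 0) = divided_jet ('X^alpha * U) v w.
  rewrite /point /= Pa0 Qa0 addr0; congr divided_jet.
    rewrite take_poly_id; last first.
      apply: leq_trans (size_polyMleq _ _) _; rewrite size_polyXn addSn /=.
      have -> : (b + N - e = k + (b + N - alpha))%N by rewrite /k; lia.
      by rewrite leq_add2l.
    by rewrite mulrA -exprD subnKC // ltnW.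
  rewrite -[RHS](take_poly_id szv); apply: eqX_take_eq.
  have -> : ('X^L + U * v) * I = U * I * v + I * 'X^L.
    by rewrite mulrDl addrC mulrAC; congr (_ + _); rewrite mulrC.
  apply: eqX_trans (eqX_addr _ _ _) _; first by rewrite /L; lia.
  rewrite -[X in eqX _ _ X]mul1r; apply: eqXM (eqX_refl _ _).
  by apply: eqX_leq UI; lia.
move=> g gvan; rewrite -point0.
have := @root_specialization K (k + L) H (fun p => g.@[point p]).
apply.
- have rC := regular_polyC (K := K).
  have rpC q : regularp (@poly_ev K) (fun=> q) by exact: regularpC.
  have rt : regularp (@poly_ev K) (fun t => t%:P).
    by apply: regularp_polyC; apply: regular_polyX.
  apply: regularpD => //; apply: regularpD => //; apply: regularpD => //.
  by apply: regularpX => //; apply: regularpD.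
- exact: monH.
- by apply: regular_meval rpoint; apply: regular_familyC.
- by move=> a t t0 Ht; apply: gvan; apply: in_chart.
by rewrite PQ Pa0 Qa0.
Qed.

Lemma exact_order_in_closure a (U v w : {poly K}) : (a <= N)%N -> U`_0 != 0 ->
    (size U <= b + N - a)%N -> (size v <= j + N)%N -> (size w <= m.-1)%N ->
    divided_eq ('X^a * U) v w ->
  image_closure (chart (minn a e)) (divided_jet ('X^a * U) v w).
Proof.
move=> aN U0 szU szv szw eq_uvw; case: (leqP a e) => [ae|ea].
  by apply: sub_zclosure; apply: chart_covers.
exact: high_order_in_closure.
Qed.

(** If [u] has order greater than [N], both sides of the equation vanish modulo
   [t ^ N], and they still do after adding a multiple of [t ^ N] to [u]. *)
Lemma charts_cover (u v w : {poly K}) : (size u <= b + N)%N -> (size v <= j + N)%N ->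
    (size w <= m.-1)%N -> divided_eq u v w ->
  exists2 a, (a <= minn N e)%N & image_closure (chart a) (divided_jet u v w).
Proof.
move=> szu szv szw eq_uvw; have [uN|[a [aN uE U0]]] := order_cases N u; last first.
  exists (minn a e); first by lia.
  rewrite uE; apply: exact_order_in_closure; rewrite -?uE //.
  by rewrite size_drop_poly leq_sub2r.
exists (minn N e) => //.
(* For t <> 0 the order of the first series is exactly N. *)
pose gamma t := divided_jet (u + t%:P * 'X^N) v w.
have -> : divided_jet u v w = gamma 0 by rewrite /gamma mul0r addr0.
apply: zclosure_limit => [|t t0].
  have rC := regular_polyC (K := K).
  have rpC q : regularp (@poly_ev K) (fun=> q) by exact: regularpC.
  apply: regular_jet_point; do 2?apply: regularpM => //.
  apply: regularpD => //; apply: regularpM => //.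
  by apply: regularp_polyC; apply: regular_polyX.
have uE : u + t%:P * 'X^N = 'X^N * (t%:P + drop_poly N.+1 u * 'X).
  rewrite {1}(dvdp_Xn_drop uN) exprSr; ring.
rewrite /gamma uE; apply: exact_order_in_closure => //.
- by rewrite coefD coefC coefMX addr0.
- apply: leq_trans (size_polyD _ _) _; rewrite geq_max; apply/andP; split.
    by apply: leq_trans (size_polyC_leq1 _) _; lia.
  apply: leq_trans (size_polyMleq _ _) _; rewrite size_polyX size_drop_poly; lia.
rewrite -uE; apply: eqX_trans eq_uvw; apply: eqXM (eqX_refl _ _).
exact: eqX_addr.
Qed.

Lemma toric_dim (Z : set ('I_(3 * m.+1) -> K)) : (n.+1 < j + b)%N ->
    zariski_closed Z ->
    (forall v, Z v <->
       jet_condition m n j b (arc_of v (inord 0)) (arc_of v (inord 1)) (arc_of v (inord 2))) ->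
  pure_dimensional Z /\ has_dim Z (2 * m).
Proof.
move=> jbn clZ ZE.
have szX k l (p : {poly K}) : (size p <= l)%N -> (l + k <= m.+1)%N ->
    (size (p * 'X^k)%R <= m.+1)%N.
  by move=> pl lk; apply: leq_trans (size_polyMleq _ _) _; rewrite size_polyXn; lia.
apply: (@dim_of_charts _ _ _ _ (minn N e) chart) => //.
- exact: polynomial_map_chart.
- by move=> a; rewrite leq_min => /andP[aN ae]; apply: chart_flag.
- move=> a s; rewrite leq_min => /andP[aN ae]; apply/ZE.
  have [szu szv szw] := chart_sizes aN ae s.
  rewrite !arc_of_jet_point //=; last 3 first.
  + by apply: szX szw _; lia.
  + by apply: szX szv _; lia.
  + by apply: szX szu _; lia.
  by apply/divided_condition; apply: chart_divided_eq.
move=> v /ZE cond; have [x0 y0 _ _] := cond.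
have z0 := jet_condition_X2 nm jbn cond.
rewrite -(jet_point_arc v) (dvdp_Xn_drop x0) (dvdp_Xn_drop y0) (dvdp_Xn_drop z0).
have sz k c : (size (drop_poly k (arc_of v c)) <= m.+1 - k)%N.
  by rewrite size_drop_poly leq_sub2r // size_arc_of.
apply: charts_cover; try by apply: leq_trans (sz _ _) _; lia.
by apply/divided_condition; rewrite -!dvdp_Xn_drop.
Qed.

End ToricCase.

Lemma intersection_dim (K : closedFieldType) (n m i j : nat)
    (hn : (2 <= n)%N) (hmn : (n <= m)%N)
    (hi : (1 <= i)%N) (hij : (i < j)%N) (hj : (j <= n)%N) :
  let Z (l : nat) : set ('I_(3 * m.+1) -> K) := Zcomp n l in
  pure_dimensional (Z i `&` Z j) /\
  (m = n -> has_dim (Z i `&` Z j) (2 * n - (j - i) + 1)%N) /\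
  ((n < m)%N ->
     ((m - n < j - i)%N -> has_dim (Z i `&` Z j) (3 * m - n - (j - i))%N) /\
     ((j - i <= m - n)%N -> has_dim (Z i `&` Z j) (2 * m)%N)).
Proof.
move=> Z; pose b := (n - i).+1.
have clZ : zariski_closed (Z i `&` Z j).
  by apply: zariski_closedI; apply: zariski_closed_Zcomp.
have ZE v : (Z i `&` Z j) v <->
    jet_condition m n j b (arc_of v (inord 0)) (arc_of v (inord 1)) (arc_of v (inord 2)).
  exact: Zcomp_interP.
have linear k : (m.+1 <= j + b)%N -> (0 < k)%N -> (m.+1 <= k * n.+1)%N ->
    (k <= 2)%N -> ((1 < k)%N -> (n < m)%N) ->
    pure_dimensional (Z i `&` Z j) /\
    has_dim (Z i `&` Z j) ((m.+1 - j) + (m.+1 - b) + (m.+1 - k)).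
  move=> mjb k0 mk k2 kn; apply: linear_dim => //; try by rewrite /b; lia.
  move=> v; rewrite ZE; split=> [cond|[x0 y0 z0]].
    have [x0 y0 z0 _] := cond; split=> //; case: (ltnP 1 k) => k1.
      have -> : k = 2%N by lia.
      by apply: jet_condition_X2 cond; [exact: kn | rewrite /b; lia].
    by have -> : k = 1%N by lia.
  split=> //.
    by apply: dvdp_trans z0; rewrite -{1}['X]expr1 dvdp_exp2l.
  apply: dvdp_sub.
    apply: (dvdp_trans (dvdp_exp2l 'X mjb)); rewrite exprD; exact: dvdp_mul.
  apply: (dvdp_trans (dvdp_exp2l 'X mk)); rewrite exprM; exact: dvdp_exp2r.
have toric : (n < m)%N -> (j - i <= m - n)%N ->
    pure_dimensional (Z i `&` Z j) /\ has_dim (Z i `&` Z j) (2 * m).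
  move=> nm cm.
  apply: (@toric_dim K n m j b (2 * n.+1 - (j + b)) (m.+1 - (j + b))) => //;
    by rewrite /b; lia.
have [mn|nm] := leqP m n.
  have {mn} mn : m = n by lia.
  have [|||||pure dim] := linear 1%N; try by rewrite /b; lia.
  split=> //; split=> [_|]; last by lia.
  by have <- : ((m.+1 - j) + (m.+1 - b) + (m.+1 - 1) = 2 * n - (j - i) + 1)%N
    by rewrite /b; lia.
have [cm|mc] := leqP (j - i) (m - n).
  have [pure dim] := toric nm cm.
  by split=> //; split=> [|_]; [lia | split=> // ?; lia].
have [|||||pure dim] := linear 2%N; try by rewrite /b; lia.
split=> //; split=> [|_]; first by lia.
split=> [_|]; last by lia.
by have <- : ((m.+1 - j) + (m.+1 - b) + (m.+1 - 2) = 3 * m - n - (j - i))%N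
  by rewrite /b; lia.
Qed.

Theorem corollary2p12 (R : realType) (n m i j : nat)
    (hn : (2 <= n)%N) (hmn : (n <= m)%N)
    (hi : (1 <= i)%N) (hij : (i < j)%N) (hj : (j <= n)%N) :
  let Z (l : nat) : set ('I_(3 * m.+1) -> R[i]%C) := Zcomp n l in
  pure_dimensional (Z i `&` Z j) /\
  (m = n -> has_dim (Z i `&` Z j) (2 * n - (j - i) + 1)%N) /\
  ((n < m)%N ->
     ((m - n < j - i)%N -> has_dim (Z i `&` Z j) (3 * m - n - (j - i))%N) /\
     ((j - i <= m - n)%N -> has_dim (Z i `&` Z j) (2 * m)%N)).
Proof. exact: intersection_dim. Qed.
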